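(* Let $\mathcal H$ be a finite-dimensional Hilbert space of dimension $N$. For every $r\in(0,1]$ and every $\mu\in\mathcal P^\infty(\mathbb P)$, $$P_r(\mu)\prec_wP_r(\lambda_*\mu).$$
   Context: $\mathbb P=\mathbb P(\mathcal H)$ is the set of positive invertible operators on $\mathcal H$ (positive definite $N\times N$ matrices). $\mathcal P^\infty(\mathbb P)$ is the set of Borel probability measures $\mu$ on $\mathbb P$ whose support is contained in $\{A:\varepsilon I\le A\le\varepsilon^{-1}I\}$ for some $\varepsilon\in(0,1)$. For $r\in(0,1]$ the power mean $P_r(\mu)$ is the unique $X\in\mathbb P$ satisfying $X=\int_{\mathbb P}X\#_rA\,d\mu(A)$, where $X\#_rA=X^{1/2}(X^{-1/2}AX^{-1/2})^rX^{1/2}$ is the weighted geometric mean. For $A\in\mathbb P$, $\lambda(A)=(\lambda_1(A),\dots,\lambda_N(A))$ is the vector of eigenvalues in decreasing order with multiplicities, identified with the diagonal matrix having these diagonal entries. $\lambda_*\mu$ is the push-forward of $\mu$ by $A\mapsto\lambda(A)$; one has $P_r(\lambda_*\mu)=\bigl([\int_{\mathbb P}\lambda_i(A)^r\,d\mu(A)]^{1/r}\bigr)_{i=1}^N$. For $A,B\in\mathbb P$, $A\prec_wB$ (weak majorization) means $\sum_{i=1}^k\lambda_i(A)\le\sum_{i=1}^k\lambda_i(B)$ for $1\le k\le N$. *)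

(* Defs.v *)
From HB Require Import structures.
From mathcomp Require Import all_boot all_order all_algebra.
From mathcomp Require Import complex sesquilinear spectral.
From mathcomp Require Import all_classical all_reals all_analysis.

Set Implicit Arguments.
Unset Strict Implicit.
Unset Printing Implicit Defensive.

Import Order.TTheory GRing.Theory Num.Theory.
Import numFieldTopology.Exports numFieldNormedType.Exports.

Local Open Scope classical_set_scope.
Local Open Scope ring_scope.
Local Open Scope sesquilinear_scope.
Local Open Scope complex_scope.

(* R[i], packaged as a numClosedFieldType so that the norm topology declared
   for abstract numeric fields is inferred on it and on matrices over it. *)
Definition Cx (R : realType) : numClosedFieldType := R[i].

Section matrices.
Context {R : realType} {N : nat}.
Local Notation C := (Cx R).
Implicit Types A B X : 'M[C]_N.

(* < A v, v > *)
Definition qform A (v : 'cV[C]_N) : C := (v ^t* *m A *m v) 0 0.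

(* The order of C makes 0 <= z and 0 < z imply that z is real. *)
Definition possemidef A : Prop :=
  A \is hermsymmx /\ forall v : 'cV[C]_N, 0 <= qform A v.

Definition posdef A : Prop :=
  A \is hermsymmx /\ forall v : 'cV[C]_N, v != 0 -> 0 < qform A v.

Definition loewner_le A B : Prop := possemidef (B - A).

(* Functional calculus for Hermitian A = U^-1 diag(d) U, U unitary, d real. *)
Definition mxfun (f : R -> R) A : 'M[C]_N :=
  invmx (spectralmx A)
  *m diag_mx (map_mx (fun z : C => (f (complex.Re z))%:C : C) (spectral_diag A))
  *m spectralmx A.

Definition mxpow A (t : R) : 'M[C]_N := mxfun (fun x => x `^ t) A.

Definition wgeomean (r : R) X A : 'M[C]_N :=
  mxpow X 2^-1 *m mxpow (mxpow X (- 2^-1) *m A *m mxpow X (- 2^-1)) r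
  *m mxpow X 2^-1.

(* Eigenvalues of a Hermitian matrix with multiplicities, in decreasing order. *)
Definition eigvals A : 'rV[R]_N :=
  \row_(i < N) (sort >=%O
    [seq complex.Re (spectral_diag A 0 j : R[i]) | j <- enum 'I_N])`_i.

Definition weak_major A B : Prop :=
  forall k : nat, (1 <= k <= N)%N ->
    \sum_(i < N | (i < k)%N) eigvals A 0 i
      <= \sum_(i < N | (i < k)%N) eigvals B 0 i.

End matrices.

Notation "A ≺w B" := (weak_major A B) (at level 70).

(* The space P of positive definite N x N matrices, with the topology induced
   from that of all matrices. *)
Definition PD (R : realType) (N : nat) : Type :=
  set_type (@posdef R N : set 'M[Cx R]_N).

HB.instance Definition _ (R : realType) (N : nat) :=
  Topological.copy (PD R N) (set_type (@posdef R N : set 'M[Cx R]_N)).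

Definition mx_of_PD (R : realType) (N : nat) (A : PD R N) : 'M[Cx R]_N :=
  set_val A.
Coercion mx_of_PD : PD >-> matrix.

Section posdef_facts.
Context {R : realType} {N : nat}.
Local Notation C := (Cx R).

Lemma posdef_spectral_diag (A : 'M[C]_N) (i : 'I_N) :
  posdef A -> 0 < spectral_diag A 0 i.
Proof.
move=> [hA pA].
pose P := spectralmx A.
have Pu : P \is unitarymx := spectral_unitarymx A.
have AE : A = invmx P *m diag_mx (spectral_diag A) *m P.
  exact/orthomx_spectralP/hermitian_normalmx.
pose v : 'cV[C]_N := invmx P *m delta_mx i 0.
have Pv : P *m v = delta_mx i 0 by rewrite mulKVmx ?spectral_unit.
have v0 : v != 0.
  apply/eqP => v0; move: Pv; rewrite v0 mulmx0 => /matrixP /(_ i 0).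
  by rewrite !mxE !eqxx => /eqP; rewrite eq_sym oner_eq0.
have := pA v v0.
rewrite /qform [in X in 0 < X -> _]AE (invmx_unitary Pu).
move: (spectral_diag A) => d; clearbody v.
have -> : v ^t* *m (P ^t* *m diag_mx d *m P) *m v
    = (P *m v) ^t* *m (diag_mx d *m (P *m v)).
  by rewrite [in RHS]trmx_mul map_mxM !mulmxA.
rewrite Pv trmx_delta map_delta_mx -rowE mxE mul_diag_mx !mxE !eqxx.
by rewrite mulr1.
Qed.

Lemma eigvals_gt0 (A : 'M[C]_N) (i : 'I_N) : posdef A -> 0 < eigvals A 0 i.
Proof.
move=> pA; rewrite mxE; set s := sort _ _.
have : s`_i \in s by rewrite mem_nth// size_sort size_map size_enum_ord.
rewrite mem_sort => /mapP[j _ ->].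
by have := posdef_spectral_diag j pA; rewrite ltcE => /andP[].
Qed.

Lemma posdef_diag (d : 'rV[R]_N) : (forall i, 0 < d 0 i) ->
  posdef (diag_mx (map_mx (fun x : R => x%:C : C) d)).
Proof.
move=> d0; split.
  apply/is_hermitianmxP; rewrite expr0 scale1r tr_diag_mx map_diag_mx.
  congr diag_mx; apply/rowP => i; rewrite !mxE.
  by apply/esym/CrealP/complex_realP; exists (d 0 i).
move=> v v0; rewrite /qform -mulmxA mxE.
have d0C i : 0 < (d 0 i)%:C :> R[i] by rewrite ltcR.
have E i : (v ^t*) 0 i * (diag_mx (map_mx (fun x : R => x%:C : C) d) *m v) i 0
    = ((d 0 i)%:C : C) * `|v i 0| ^+ 2.
  by rewrite mul_diag_mx !mxE mulrCA normCK [_^* * _]mulrC.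
have [i vi0] : exists i, v i 0 != 0.
  apply/existsP; rewrite -negb_forall; apply: contra v0 => /forallP v0.
  by apply/eqP/matrixP => i j; rewrite ord1 !mxE; exact/eqP.
rewrite (bigD1 i)//= ltr_wpDr//.
  apply: sumr_ge0 => j _; rewrite E mulr_ge0 ?exprn_ge0//.
  exact: ltW (d0C j).
by rewrite E mulr_gt0 ?exprn_gt0 ?normr_gt0//; exact: (d0C i).
Qed.

Definition diagPD (d : 'rV[R]_N) (d0 : forall i, 0 < d 0 i) : PD R N :=
  SigSub (mem_set (posdef_diag d0)).

Lemma PD_posdef (A : PD R N) : posdef (A : 'M[C]_N).
Proof. by case: A => A pA; exact: set_mem pA. Qed.

(* A |-> lambda(A), the vector of eigenvalues being seen as a diagonal matrix *)
Definition eigdiag (A : PD R N) : PD R N :=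
  diagPD (fun i => eigvals_gt0 i (PD_posdef A)).

End posdef_facts.

HB.instance Definition _ (R : realType) (N : nat) :=
  isPointed.Build (PD R N)
    (@diagPD R N (const_mx 1)
       (fun i => eq_ind_r (fun x : R => 0 < x) ltr01 (mxE _ _ _ _))).

Definition borel (T : ptopologicalType) := g_sigma_algebraType (@open T).

Definition msupport (R : realType) (T : ptopologicalType)
    (mu : set (borel T) -> \bar R) : set T :=
  [set x | forall U : set T, open U -> U x -> (0 < mu U)%E].

Section power_mean.
Context {R : realType} {N : nat}.
Local Notation C := (Cx R).
Local Notation BPD := (borel (PD R N)).

(* The probability measures mu satisfying this form P^oo(P). *)
Definition bounded_support (mu : set BPD -> \bar R) : Prop :=
  exists e : R, [/\ 0 < e, e < 1 &
    msupport mu `<=` [set A : PD R N |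
      loewner_le (e%:C : C)%:M A /\ loewner_le A (e^-1%:C : C)%:M]].

(* Entrywise integral of a matrix-valued function *)
Definition mxintegral (mu : set BPD -> \bar R) (F : PD R N -> 'M[C]_N) :
    'M[C]_N :=
  \matrix_(i, j)
    (Complex (fine (\int[mu]_(A in [set: BPD]) (complex.Re (F A i j : R[i]))%:E)%E)
             (fine (\int[mu]_(A in [set: BPD]) (complex.Im (F A i j : R[i]))%:E)%E)
     : C).

(* lambda_* mu *)
Definition eig_pushforward (mu : set BPD -> \bar R) : set BPD -> \bar R :=
  pushforward mu (eigdiag : BPD -> BPD).

(* [get] picks the solution X, which exists and is unique when 0 < r <= 1 and
   mu is a Borel probability measure of bounded support. The argument mu is a
   bare set function so that this applies to [eig_pushforward mu] without
   a proof that eigdiag is measurable. *)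
Definition power_mean (r : R) (mu : set BPD -> \bar R) : PD R N :=
  get [set X : PD R N | X = mxintegral mu (fun A => wgeomean r X A) :> 'M[C]_N].

End power_mean.

(* Main.v *)
(** Write [X #_r A] for [wgeomean r X A] and let [X] be the power mean of [mu].
    Summing [X = \int (X #_r A) dmu(A)] over orthonormal eigenvectors of [X]
    for its [k] largest eigenvalues, Ky Fan's principle bounds the [k]-th
    partial sum of [lambda(X)] by the integral of that of [lambda(X #_r A)].
    The Cauchy-Binet formula and Hoelder's inequality give
    [det (V^* (X #_r A) V) <= det (V^* X V)^(1-r) det (V^* A V)^r] for
    isometries [V], hence the log-majorization, and then the weak majorization,
    of [lambda(X #_r A)] by [lambda(X)^(1-r) lambda(A)^r]. With
    [d_i = (\int lambda_i(A)^r dmu(A))^(1/r)], Young's inequality turns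
    [\sum x_i <= \sum x_i^(1-r) d_i^r] into [\sum x_i <= \sum d_i].

    By the Loewner-Heinz inequality, [F : X |-> \int (X #_r A) dmu(A)] is
    order-preserving, and it is homogeneous of degree [p = 1 - r < 1]. Iterating
    [c Y <= X -> c^p F Y <= F X] compares fixed points and yields both the
    existence of [X] and [diag d <= Y] for the power mean [Y] of [lambda_* mu].
    The same two properties in [A] give the continuity needed for
    measurability. *)

Require Import Defs.
From HB Require Import structures.
From mathcomp Require Import all_boot all_order all_algebra perm.
From mathcomp Require Import complex sesquilinear spectral ring lra.
From mathcomp Require Import all_classical all_reals all_analysis.

Set Implicit Arguments.
Unset Strict Implicit.
Unset Printing Implicit Defensive.

Import Order.TTheory GRing.Theory Num.Theory.
Import numFieldTopology.Exports numFieldNormedType.Exports.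

Local Open Scope classical_set_scope.
Local Open Scope ring_scope.
Local Open Scope sesquilinear_scope.

(** * Quadratic forms and the Loewner order *)

Definition cplx {R : realType} (x : R) : Cx R := Complex x 0.
Definition re {R : realType} (z : Cx R) : R := complex.Re (z : R[i]).
Definition im {R : realType} (z : Cx R) : R := complex.Im (z : R[i]).
Definition sqmod {R : realType} (z : Cx R) : R := re z ^+ 2 + im z ^+ 2.

Notation "x %:Cx" := (cplx x) (at level 1, format "x %:Cx").

Section complex_coordinates.
Context {R : realType}.
Local Notation C := (Cx R).
Implicit Types (x y : R) (z w : C).

Fact cplx_is_zmod_morphism : zmod_morphism (@cplx R).
Proof. by move=> x y; rewrite -[LHS]/(real_complex R (x - y)) rmorphB. Qed.

Fact cplx_is_monoid_morphism : monoid_morphism (@cplx R).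
Proof.
by split=> // x y; rewrite -[LHS]/(real_complex R (x * y)) rmorphM.
Qed.

Fact re_is_zmod_morphism : zmod_morphism (@re R).
Proof. by case=> a b [c d]. Qed.

Fact im_is_zmod_morphism : zmod_morphism (@im R).
Proof. by case=> a b [c d]. Qed.

HB.instance Definition _ :=
  GRing.isZmodMorphism.Build R C cplx cplx_is_zmod_morphism.
HB.instance Definition _ :=
  GRing.isMonoidMorphism.Build R C cplx cplx_is_monoid_morphism.
HB.instance Definition _ :=
  GRing.isZmodMorphism.Build C R re re_is_zmod_morphism.
HB.instance Definition _ :=
  GRing.isZmodMorphism.Build C R im im_is_zmod_morphism.

Lemma re_cplx : cancel (@cplx R) (@re R). Proof. by []. Qed.

Lemma im_cplx x : im x%:Cx = 0. Proof. by []. Qed.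

Lemma eq_re_im z w : re z = re w -> im z = im w -> z = w.
Proof. by case: z w => a b [c d]; rewrite /re /im /= => -> ->. Qed.

Lemma reM z w : re (z * w) = re z * re w - im z * im w.
Proof. by case: z w => a b [c d]. Qed.

Lemma re_conj z : re z^* = re z. Proof. by case: z. Qed.

Lemma im_conj z : im z^* = - im z. Proof. by case: z. Qed.

Lemma re_mulCx x z : re (x%:Cx * z) = x * re z.
Proof. by rewrite reM re_cplx im_cplx mul0r subr0. Qed.

Lemma re_mulCi z : re ('i * z) = - im z.
Proof. by case: z => a b; rewrite /re /im /= mul0r mul1r sub0r. Qed.

Lemma conj_cplx x : (x%:Cx)^* = x%:Cx.
Proof. exact: (conjc_real x). Qed.

Lemma conj_eq_cplx z : z^* = z -> z = (re z)%:Cx.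
Proof.
move=> zE; apply: eq_re_im => //; have := im_conj z; rewrite zE im_cplx.
by move=> /eqP; rewrite -addr_eq0 -mulr2n mulrn_eq0 => /eqP.
Qed.

Lemma cplx_ge0 x : (0 <= x%:Cx) = (0 <= x). Proof. exact: (lecR 0 x). Qed.

Lemma cplx_gt0 x : (0 < x%:Cx) = (0 < x). Proof. exact: (ltcR 0 x). Qed.

Lemma ler_cplx x y : (x%:Cx <= y%:Cx) = (x <= y).
Proof. exact: lecR. Qed.

Lemma ltr_cplx x y : (x%:Cx < y%:Cx) = (x < y).
Proof. exact: ltcR. Qed.

Lemma normC_sqmod z : `|z| ^+ 2 = (sqmod z)%:Cx.
Proof. exact/esym/(add_Re2_Im2 (z : R[i])). Qed.

Lemma conjM_sqmod z : z^* * z = (sqmod z)%:Cx.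
Proof. by rewrite mulrC -normCK normC_sqmod. Qed.

Lemma normC_cplx x : `|x%:Cx| = `|x|%:Cx.
Proof.
apply/eqP; rewrite -(@eqrXn2 _ 2)// ?cplx_ge0// normCK conj_cplx.
by rewrite -rmorphM -rmorphXn /= -expr2 real_normK ?num_real.
Qed.

Lemma ge_norm_re z : `|re z|%:Cx <= `|z|.
Proof. exact: (normc_ge_Re (z : R[i])). Qed.

Lemma ler_normC_re_im z : `|z| <= (`|re z| + `|im z|)%:Cx.
Proof.
have zE : z = (re z)%:Cx + 'i * (im z)%:Cx := complexE (z : R[i]).
rewrite {1}zE; apply: (le_trans (ler_normD _ _)).
by rewrite normrM normCi mul1r !normC_cplx -rmorphD.
Qed.

Lemma gt0_cplx_re z : 0 < z -> z = (re z)%:Cx.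
Proof. by move=> z0; apply/conj_eq_cplx/CrealP; exact: gtr0_real. Qed.

Lemma sqmod_ge0 z : 0 <= sqmod z.
Proof. by rewrite addr_ge0 ?sqr_ge0. Qed.

Lemma sqmod_eq0 z : (sqmod z == 0) = (z == 0).
Proof.
by rewrite -(inj_eq (can_inj re_cplx)) rmorph0 -normC_sqmod sqrf_eq0 normr_eq0.
Qed.

End complex_coordinates.

Definition rform {R : realType} {n} (A : 'M[Cx R]_n) (v : 'cV[Cx R]_n) : R :=
  re (qform A v).

Definition sform {R : realType} {n} (A : 'M[Cx R]_n) (u v : 'cV[Cx R]_n) :
  Cx R := (u^t* *m A *m v) 0 0.

Definition sqnorm {R : realType} {n} (v : 'cV[Cx R]_n) : R :=
  \sum_i sqmod (v i 0).

Definition rdiag {R : realType} {n} (d : 'rV[R]_n) : 'M[Cx R]_n :=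
  diag_mx (map_mx cplx d).

(* For Hermitian matrices this is the Loewner order. *)
Definition fle {R : realType} {n} (A B : 'M[Cx R]_n) : Prop :=
  forall v, rform A v <= rform B v.

Notation "A ⪯ B" := (fle A B) (at level 70).

Definition scalar_between {R : realType} {n} (a b : R) (A : 'M[Cx R]_n) :
  Prop := (a%:Cx)%:M ⪯ A /\ A ⪯ (b%:Cx)%:M.

Section hermitian_matrices.
Context {R : realType}.
Local Notation C := (Cx R).

Lemma adjM m n p (A : 'M[C]_(m, n)) (B : 'M[C]_(n, p)) :
  (A *m B)^t* = B^t* *m A^t*.
Proof. by rewrite trmx_mul map_mxM. Qed.

Lemma hermsymmxP n (A : 'M[C]_n) : reflect (A^t* = A) (A \is hermsymmx).
Proof.
by apply: (iffP (is_hermitianmxP _ _ _)); rewrite expr0 scale1r => /esym.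
Qed.

Lemma hermsymmxE n (A : 'M[C]_n) i j : A \is hermsymmx -> A i j = (A j i)^*.
Proof. by move=> /hermsymmxP {1}<-; rewrite !mxE. Qed.

Lemma hermsymmxB n (A B : 'M[C]_n) :
  A \is hermsymmx -> B \is hermsymmx -> A - B \is hermsymmx.
Proof.
move=> /hermsymmxP hA /hermsymmxP hB; apply/hermsymmxP.
by rewrite linearB /= map_mxB hA hB.
Qed.

Lemma hermsymmxZ n (c : R) (A : 'M[C]_n) :
  A \is hermsymmx -> c%:Cx *: A \is hermsymmx.
Proof.
move=> /hermsymmxP hA; apply/hermsymmxP.
by rewrite linearZ /= map_mxZ /= conj_cplx hA.
Qed.

Lemma hermsymmx_conj m n (A : 'M[C]_m) (W : 'M[C]_(m, n)) :
  A \is hermsymmx -> W^t* *m A *m W \is hermsymmx.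
Proof.
by move=> /hermsymmxP hA; apply/hermsymmxP; rewrite !adjM trmxCK hA mulmxA.
Qed.

Lemma hermsymmx_rdiag n (d : 'rV[R]_n) : rdiag d \is hermsymmx.
Proof.
apply/hermsymmxP; rewrite tr_diag_mx map_diag_mx; congr diag_mx.
by apply/rowP => i; rewrite !mxE /= conj_cplx.
Qed.

Lemma qform_hermsymmx n (A : 'M[C]_n) v :
  A \is hermsymmx -> qform A v = (rform A v)%:Cx.
Proof.
by move=> hA; apply: conj_eq_cplx; rewrite /qform -hermsymmxE ?hermsymmx_conj.
Qed.

End hermitian_matrices.

Section quadratic_forms.
Context {R : realType}.
Local Notation C := (Cx R).

Lemma rformD n (A B : 'M[C]_n) v : rform (A + B) v = rform A v + rform B v.
Proof. by rewrite /rform /qform mulmxDr mulmxDl mxE raddfD. Qed.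

Lemma rformN n (A : 'M[C]_n) v : rform (- A) v = - rform A v.
Proof. by rewrite /rform /qform mulmxN mulNmx mxE raddfN. Qed.

Lemma rformB n (A B : 'M[C]_n) v : rform (A - B) v = rform A v - rform B v.
Proof. by rewrite rformD rformN. Qed.

Lemma rformZ n c (A : 'M[C]_n) v : rform (c%:Cx *: A) v = c * rform A v.
Proof. by rewrite /rform /qform -scalemxAr -scalemxAl mxE re_mulCx. Qed.

Lemma rform_conj m n (A : 'M[C]_m) (W : 'M[C]_(m, n)) v :
  rform (W^t* *m A *m W) v = rform A (W *m v).
Proof. by rewrite /rform /qform adjM !mulmxA. Qed.

Lemma rform_sandwich n (A W : 'M[C]_n) v :
  W \is hermsymmx -> rform (W *m A *m W) v = rform A (W *m v).
Proof. by move=> /hermsymmxP {1}<-; rewrite rform_conj. Qed.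

Lemma rform0r n (A : 'M[C]_n) : rform A 0 = 0.
Proof. by rewrite /rform /qform mulmx0 mxE. Qed.

Lemma rform_rdiag n (d : 'rV[R]_n) v :
  rform (rdiag d) v = \sum_i d 0 i * sqmod (v i 0).
Proof.
rewrite /rform /qform -mulmxA mxE raddf_sum /=; apply: eq_bigr => i _.
by rewrite mul_diag_mx !mxE mulrCA conjM_sqmod re_mulCx re_cplx.
Qed.

Lemma rdiag_const n (c : R) : rdiag (const_mx c) = (c%:Cx)%:M :> 'M[C]_n.
Proof. by rewrite -diag_const_mx /rdiag map_const_mx. Qed.

Lemma rform_scalar n (c : R) v : rform ((c%:Cx)%:M : 'M[C]_n) v = c * sqnorm v.
Proof.
rewrite -rdiag_const rform_rdiag mulr_sumr.
by apply: eq_bigr => i _; rewrite mxE.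
Qed.

Lemma rform1 n v : rform (1%:M : 'M[C]_n) v = sqnorm v.
Proof. by rewrite -[1%:M]/((1%:Cx)%:M) rform_scalar mul1r. Qed.

Lemma rform_eigenl n (A B : 'M[C]_n) v (c : R) :
  A \is hermsymmx -> A *m v = c%:Cx *: v -> rform (A *m B) v = c * rform B v.
Proof.
move=> /hermsymmxP hA Av; rewrite /rform /qform !mulmxA -{1}hA -adjM Av.
rewrite [(_ *: _)^T]linearZ /= map_mxZ /= conj_cplx -!scalemxAl mxE.
exact: re_mulCx.
Qed.

Lemma rform_eigenr n (A B : 'M[C]_n) v (c : R) :
  A *m v = c%:Cx *: v -> rform (B *m A) v = c * rform B v.
Proof.
move=> Av; rewrite /rform /qform !mulmxA -(mulmxA _ A v) Av -scalemxAr mxE.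
exact: re_mulCx.
Qed.

Lemma rform_delta n (A : 'M[C]_n) i : rform A (delta_mx i 0) = re (A i i).
Proof.
by rewrite /rform /qform trmx_delta map_delta_mx -rowE -colE !mxE.
Qed.

Lemma rform_rdiag_delta n (d : 'rV[R]_n) i :
  rform (rdiag d) (delta_mx i 0) = d 0 i.
Proof. by rewrite rform_delta !mxE eqxx. Qed.

Lemma sqnorm_ge0 n (v : 'cV[C]_n) : 0 <= sqnorm v.
Proof. by apply: sumr_ge0 => i _; exact: sqmod_ge0. Qed.

Lemma sqnorm_gt0 n (v : 'cV[C]_n) : (0 < sqnorm v) = (v != 0).
Proof.
rewrite lt_neqAle sqnorm_ge0 andbT eq_sym; congr (~~ _); apply/eqP/eqP => [|->].
  move=> /psumr_eq0P v0; apply/colP => i; rewrite mxE; apply/eqP.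
  by rewrite -sqmod_eq0 v0// => j _; exact: sqmod_ge0.
by apply: big1 => i _; rewrite mxE; apply/eqP; rewrite sqmod_eq0.
Qed.

Lemma rformE n (A : 'M[C]_n) v : rform A v =
  \sum_i \sum_j (re ((v i 0)^* * v j 0) * re (A i j) -
                 im ((v i 0)^* * v j 0) * im (A i j)).
Proof.
rewrite /rform /qform mxE raddf_sum exchange_big /=; apply: eq_bigr => j _.
rewrite mxE mulr_suml raddf_sum; apply: eq_bigr => i _.
by rewrite /= !mxE mulrAC [LHS]reM.
Qed.

Lemma sformDl n (A : 'M[C]_n) u u' v :
  sform A (u + u') v = sform A u v + sform A u' v.
Proof. by rewrite /sform [(u + u')^T]linearD /= map_mxD !mulmxDl mxE. Qed.

Lemma sformDr n (A : 'M[C]_n) u v v' :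
  sform A u (v + v') = sform A u v + sform A u v'.
Proof. by rewrite /sform mulmxDr mxE. Qed.

Lemma sformZl n (A : 'M[C]_n) c u v : sform A (c *: u) v = c^* * sform A u v.
Proof. by rewrite /sform [(c *: u)^T]linearZ /= map_mxZ -!scalemxAl mxE. Qed.

Lemma sformZr n (A : 'M[C]_n) c u v : sform A u (c *: v) = c * sform A u v.
Proof. by rewrite /sform -scalemxAr mxE. Qed.

Lemma sform_delta n (A : 'M[C]_n) (i j : 'I_n) :
  sform A (delta_mx i 0) (delta_mx j 0) = A i j.
Proof. by rewrite /sform trmx_delta map_delta_mx -rowE -colE !mxE. Qed.

Lemma re_polarization n (A : 'M[C]_n) i j : A \is hermsymmx ->
  re (A i j) = (rform A (delta_mx i 0 + delta_mx j 0) -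
                rform A (delta_mx i 0) - rform A (delta_mx j 0)) / 2.
Proof.
move=> hA; rewrite !rform_delta /rform -[qform _ _]/(sform _ _ _).
rewrite sformDl !sformDr !sform_delta (hermsymmxE j i hA) !raddfD /= re_conj.
move: (re _) (re _) (re _) => x y z; lra.
Qed.

Lemma im_polarization n (A : 'M[C]_n) i j : A \is hermsymmx ->
  im (A i j) = (rform A (delta_mx i 0) + rform A (delta_mx j 0) -
                rform A (delta_mx i 0 + 'i *: delta_mx j 0)) / 2.
Proof.
move=> hA; rewrite !rform_delta /rform -[qform _ (_ + _)]/(sform _ _ _).
rewrite sformDl !sformDr !sformZl !sformZr !sform_delta (hermsymmxE j i hA).
rewrite conjCi !mulrA !mulNr -expr2 sqrCi mulN1r opprK !raddfD raddfN /=.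
rewrite !re_mulCi im_conj; move: (re _) (re _) (im _) => x y z; lra.
Qed.

Lemma eq_rform n (A B : 'M[C]_n) : A \is hermsymmx -> B \is hermsymmx ->
  rform A =1 rform B -> A = B.
Proof.
move=> hA hB AB; apply/matrixP => i j.
apply: eq_re_im.
  by rewrite (re_polarization _ _ hA) (re_polarization _ _ hB) !AB.
by rewrite (im_polarization _ _ hA) (im_polarization _ _ hB) !AB.
Qed.

End quadratic_forms.

Section loewner_order.
Context {R : realType}.
Local Notation C := (Cx R).

Lemma fle_trans n (B A D : 'M[C]_n) : A ⪯ B -> B ⪯ D -> A ⪯ D.
Proof. by move=> AB BD v; exact: le_trans (AB v) (BD v). Qed.

Lemma fle_anti n (A B : 'M[C]_n) :
  A \is hermsymmx -> B \is hermsymmx -> A ⪯ B -> B ⪯ A -> A = B.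
Proof.
move=> hA hB AB BA; apply: (eq_rform hA hB) => v.
by apply/le_anti; rewrite AB BA.
Qed.

Lemma fle_sandwich n (A B W : 'M[C]_n) : W \is hermsymmx -> A ⪯ B ->
  W *m A *m W ⪯ W *m B *m W.
Proof. by move=> hW AB v; rewrite !rform_sandwich. Qed.

Lemma loewner_le_fle n (A B : 'M[C]_n) : loewner_le A B -> A ⪯ B.
Proof.
move=> [hAB AB] v; rewrite -subr_ge0 -rformB.
by have := AB v; rewrite qform_hermsymmx// cplx_ge0.
Qed.

Lemma posdefP n (A : 'M[C]_n) :
  posdef A <-> A \is hermsymmx /\ forall v, v != 0 -> 0 < rform A v.
Proof.
split=> -[hA pA]; split=> // v /pA; first by rewrite qform_hermsymmx// cplx_gt0.
by move=> ?; rewrite qform_hermsymmx// cplx_gt0.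
Qed.

Lemma posdef_herm n (A : 'M[C]_n) : posdef A -> A \is hermsymmx.
Proof. by case. Qed.

Lemma posdef_rform_gt0 n (A : 'M[C]_n) v : posdef A -> v != 0 -> 0 < rform A v.
Proof. by move=> /posdefP[_]; apply. Qed.

Lemma posdef_rform_ge0 n (A : 'M[C]_n) v : posdef A -> 0 <= rform A v.
Proof.
move=> pA; have [->|/(posdef_rform_gt0 pA)/ltW//] := eqVneq v 0.
by rewrite rform0r.
Qed.

Lemma posdef_fle n (A B : 'M[C]_n) :
  posdef A -> B \is hermsymmx -> A ⪯ B -> posdef B.
Proof.
move=> pA hB AB; apply/posdefP; split=> // v v0.
exact: lt_le_trans (posdef_rform_gt0 pA v0) (AB v).
Qed.

Lemma posdef_conj m n (A : 'M[C]_m) (W : 'M[C]_(m, n)) (V : 'M[C]_(n, m)) :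
  V *m W = 1%:M -> posdef A -> posdef (W^t* *m A *m W).
Proof.
move=> VW pA; apply/posdefP; split=> [|v v0].
  exact/hermsymmx_conj/posdef_herm.
rewrite rform_conj posdef_rform_gt0//; apply: contra v0 => /eqP Wv.
by rewrite -[v]mul1mx -VW -mulmxA Wv mulmx0.
Qed.

Lemma posdef_sandwich n (A W V : 'M[C]_n) : W \is hermsymmx -> V *m W = 1%:M ->
  posdef A -> posdef (W *m A *m W).
Proof. by move=> /hermsymmxP {2}<-; exact: posdef_conj. Qed.

Lemma posdefZ n (c : R) (A : 'M[C]_n) :
  0 < c -> posdef A -> posdef (c%:Cx *: A).
Proof.
move=> c0 pA; apply/posdefP; split=> [|v v0].
  exact/hermsymmxZ/posdef_herm.
by rewrite rformZ mulr_gt0// posdef_rform_gt0.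
Qed.

Lemma posdef_scalar n (c : R) : 0 < c -> posdef ((c%:Cx)%:M : 'M[C]_n).
Proof.
move=> c0; apply/posdefP; split=> [|v v0].
  by rewrite -rdiag_const hermsymmx_rdiag.
by rewrite rform_scalar mulr_gt0// sqnorm_gt0.
Qed.

End loewner_order.

(** * Functional calculus of Hermitian matrices *)

Definition conjdiag {R : realType} {m n} (W : 'M[Cx R]_(m, n)) (d : 'rV[R]_m) :
  'M[Cx R]_n := W^t* *m rdiag d *m W.

Section diagonalization.
Context {R : realType}.
Local Notation C := (Cx R).

Lemma rdiagM n (a b : 'rV[R]_n) :
  rdiag a *m rdiag b = rdiag (\row_i (a 0 i * b 0 i)).
Proof.
rewrite mulmx_diag; congr diag_mx; apply/rowP => i.
by rewrite !mxE rmorphM.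
Qed.

Lemma unitarymx1 n : (1%:M : 'M[C]_n) \is unitarymx.
Proof. by apply/unitarymxP; rewrite trmx1 map_mx1 mul1mx. Qed.

Lemma unitarymx_adj n (U : 'M[C]_n) : U \is unitarymx -> U^t* *m U = 1%:M.
Proof. by move=> /unitarymxP; exact: mulmx1C. Qed.

Lemma conjdiagE m n (W : 'M[C]_(m, n)) d i j :
  conjdiag W d i j = \sum_l (W l i)^* * (d 0 l)%:Cx * W l j.
Proof.
by rewrite mxE; apply: eq_bigr => l _; rewrite mul_mx_diag !mxE.
Qed.

Lemma hermsymmx_conjdiag m n (W : 'M[C]_(m, n)) d :
  conjdiag W d \is hermsymmx.
Proof. exact/hermsymmx_conj/hermsymmx_rdiag. Qed.

Lemma rform_conjdiag m n (W : 'M[C]_(m, n)) d v :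
  rform (conjdiag W d) v = \sum_i d 0 i * sqmod ((W *m v) i 0).
Proof. by rewrite rform_conj rform_rdiag. Qed.

Lemma conj_conjdiag m n p (U : 'M[C]_(m, n)) d (W : 'M[C]_(n, p)) :
  W^t* *m conjdiag U d *m W = conjdiag (U *m W) d.
Proof. by rewrite /conjdiag adjM !mulmxA. Qed.

Lemma conjdiag1 n (d : 'rV[R]_n) : conjdiag 1%:M d = rdiag d.
Proof. by rewrite /conjdiag mulmx1 trmx1 map_mx1 mul1mx. Qed.

Lemma conjdiag_const1 m n (W : 'M[C]_(m, n)) :
  conjdiag W (const_mx 1) = W^t* *m W.
Proof. by rewrite /conjdiag rdiag_const mulmx1. Qed.

Lemma conjdiagZ m n (W : 'M[C]_(m, n)) (c : R) d :
  conjdiag W (c *: d) = c%:Cx *: conjdiag W d.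
Proof.
rewrite /conjdiag (_ : rdiag _ = c%:Cx *: rdiag d); last first.
  by rewrite /rdiag map_mxZ linearZ.
by rewrite -scalemxAr -scalemxAl.
Qed.

Lemma conjdiag_const n (U : 'M[C]_n) (c : R) : U \is unitarymx ->
  conjdiag U (const_mx c) = (c%:Cx)%:M.
Proof.
move=> uU; rewrite -[c]mulr1 -scalemx_const conjdiagZ conjdiag_const1.
by rewrite unitarymx_adj// scalemx1 mulr1.
Qed.

Lemma conjdiagM n (U : 'M[C]_n) a b : U \is unitarymx ->
  conjdiag U a *m conjdiag U b = conjdiag U (\row_i (a 0 i * b 0 i)).
Proof.
move=> /unitarymxP uU; rewrite /conjdiag !mulmxA -(mulmxA _ U) uU mulmx1.
by rewrite -(mulmxA _ (rdiag a)) rdiagM.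
Qed.

Lemma sqnorm_unitarymx n (U : 'M[C]_n) v : U \is unitarymx ->
  sqnorm (U *m v) = sqnorm v.
Proof. by move=> uU; rewrite -!rform1 -rform_conj mulmx1 unitarymx_adj. Qed.

Lemma scalar_between_conjdiag n (U : 'M[C]_n) (d : 'rV[R]_n) (a b : R) :
  U \is unitarymx -> (forall i, a <= d 0 i <= b) ->
  scalar_between a b (conjdiag U d).
Proof.
move=> uU dab; split=> v;
  rewrite rform_scalar -(sqnorm_unitarymx v uU) rform_conjdiag mulr_sumr;
  apply: ler_sum => i _; rewrite ler_wpM2r ?sqmod_ge0//;
  by have /andP[] := dab i.
Qed.

Lemma conjdiag_eigenvector n (U : 'M[C]_n) d i : U \is unitarymx ->
  conjdiag U d *m (U^t* *m delta_mx i 0) =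
    (d 0 i)%:Cx *: (U^t* *m delta_mx i 0 : 'cV[C]_n).
Proof.
move=> /unitarymxP uU; rewrite /conjdiag -!mulmxA (mulmxA U) uU mul1mx.
rewrite scalemxAr; congr (_ *m _); apply/colP => j.
rewrite mul_diag_mx !mxE andbT.
by case: eqVneq => [->|_]; rewrite ?mulr0.
Qed.

Lemma posdef_conjdiag n (U : 'M[C]_n) (d : 'rV[R]_n) :
  U \is unitarymx -> (forall i, 0 < d 0 i) -> posdef (conjdiag U d).
Proof.
move=> uU d0; apply: (posdef_conj (unitarymx_adj uU)).
exact: (@posdef_diag _ _ d).
Qed.

End diagonalization.

Section spectral_theorem.
Context {R : realType}.
Local Notation C := (Cx R).

Lemma eigvals_perm n (A : 'M[C]_n) : exists s : 'S_n,
  forall i, eigvals A 0 i = re (spectral_diag A 0 (s i)).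
Proof.
pose t := mktuple (fun j => re (spectral_diag A 0 j)).
have sorted_size : size (sort >=%O t) == n by rewrite size_sort size_tuple.
have /tuple_permP[s tE] : perm_eq (Tuple sorted_size) t by rewrite perm_sort.
exists s => i; rewrite mxE.
have := congr1 (fun x : seq R => x`_i) tE; rewrite /= => ->.
by rewrite (nth_map i) ?size_enum_ord// nth_ord_enum tnth_mktuple.
Qed.

Lemma eigvals_nonincreasing n (A : 'M[C]_n) (i j : 'I_n) : (i <= j)%N ->
  eigvals A 0 j <= eigvals A 0 i.
Proof.
move=> ij; rewrite !mxE; set s := sort _ _.
have size_s : size s = n by rewrite size_sort size_map size_enum_ord.
have s_sorted : sorted >=%O s by apply: sort_sorted => x y; exact: le_total.
apply: (@sorted_leq_nth _ >=%O _ _ 0 s s_sorted i j) => //.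
- by move=> x y z /= xy yz; exact: le_trans yz xy.
- by move=> x /=.
- by rewrite inE size_s.
- by rewrite inE size_s.
Qed.

Lemma hermsymmx_spectralE n (A : 'M[C]_n) : A \is hermsymmx ->
  A = conjdiag (spectralmx A) (map_mx re (spectral_diag A)).
Proof.
move=> hA; rewrite {1}(orthomx_spectralP (hermitian_normalmx hA)).
rewrite (invmx_unitary (spectral_unitarymx A)) /conjdiag /rdiag.
congr (_ *m diag_mx _ *m _); apply/rowP => i; rewrite !mxE.
apply/conj_eq_cplx/CrealP.
by have /mxOverP := hermitian_spectral_diag_real hA; apply.
Qed.

Lemma hermsymmx_spectral n (A : 'M[C]_n) : A \is hermsymmx ->
  exists2 U : 'M[C]_n, U \is unitarymx & A = conjdiag U (eigvals A).
Proof.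
move=> hA; have [s sE] := eigvals_perm A.
exists (perm_mx s *m spectralmx A).
  apply: mul_unitarymx (spectral_unitarymx A).
  by apply/unitarymxP; rewrite tr_perm_mx map_perm_mx -perm_mxM mulgV perm_mx1.
rewrite {1}(hermsymmx_spectralE hA) -row_permE; apply/matrixP => i j.
rewrite !conjdiagE (reindex_inj (@perm_inj _ s)); apply: eq_bigr => l _.
by rewrite !mxE -sE mxE.
Qed.

Lemma eigvals_eigenvector n (A : 'M[C]_n) i : A \is hermsymmx ->
  exists2 v : 'cV[C]_n, sqnorm v = 1 & A *m v = (eigvals A 0 i)%:Cx *: v.
Proof.
move=> /hermsymmx_spectral[U uU AE]; exists (U^t* *m delta_mx i 0).
  rewrite -(sqnorm_unitarymx _ uU) mulmxA (unitarymxP uU) mul1mx.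
  by rewrite -rform1 rform_delta mxE eqxx.
by rewrite {1}AE (conjdiag_eigenvector _ _ uU).
Qed.

Lemma eigvals_rform n (A : 'M[C]_n) i : A \is hermsymmx ->
  exists2 v : 'cV[C]_n, sqnorm v = 1 & rform A v = eigvals A 0 i.
Proof.
move=> hA; have [v v1 Av] := eigvals_eigenvector i hA; exists v => //.
by rewrite -[X in rform X _]mul1mx (rform_eigenr _ Av) rform1 v1 mulr1.
Qed.

Lemma eigvals_between n (A : 'M[C]_n) (a b : R) i : A \is hermsymmx ->
  scalar_between a b A -> a <= eigvals A 0 i <= b.
Proof.
move=> hA [aA Ab]; have [v v1 <-] := eigvals_rform i hA.
by have := aA v; have := Ab v; rewrite !rform_scalar v1 !mulr1 => -> ->.
Qed.

Lemma posdef_spectral n (A : 'M[C]_n) : posdef A ->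
  exists (U : 'M[C]_n) (d : 'rV[R]_n),
    [/\ U \is unitarymx, A = conjdiag U d & forall i, 0 < d 0 i].
Proof.
move=> pA; have [U uU AE] := hermsymmx_spectral (posdef_herm pA).
by exists U, (eigvals A); split=> // i; exact: eigvals_gt0.
Qed.

(* In eigenbases of [A] and [B] the relation [A W = W B] says that each entry
   of [W] vanishes or relates equal eigenvalues. *)
Lemma conjdiag_intertwineP n (U V W : 'M[C]_n) a b :
  U \is unitarymx -> V \is unitarymx ->
  conjdiag U a *m W = W *m conjdiag V b <->
  forall i j, ((U *m W *m V^t*) i j == 0) || (a 0 i == b 0 j).
Proof.
move=> uU uV; set Z := U *m W *m V^t*.
have aZE : U *m (conjdiag U a *m W) *m V^t* = rdiag a *m Z.
  by rewrite /Z !mulmxA (unitarymxP uU) mul1mx.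
have ZbE : U *m (W *m conjdiag V b) *m V^t* = Z *m rdiag b.
  by rewrite /Z -!mulmxA (unitarymxP uV) mulmx1.
have entry i j : ((rdiag a *m Z) i j == (Z *m rdiag b) i j) =
    (Z i j == 0) || (a 0 i == b 0 j).
  rewrite mul_diag_mx mul_mx_diag !mxE mulrC -subr_eq0 -mulrBr mulf_eq0.
  by rewrite subr_eq0 (inj_eq (can_inj (@re_cplx R))).
split=> [AW i j|Zab].
  by rewrite -entry -aZE -ZbE AW.
have UV_inj (X Y : 'M[C]_n) : U *m X *m V^t* = U *m Y *m V^t* -> X = Y.
  move=> /(congr1 (fun M => U^t* *m M *m V)).
  by rewrite !mulmxA !mulmxKtV// unitarymx_adj// !mul1mx.
apply: UV_inj; rewrite aZE ZbE; apply/matrixP => i j.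
by apply/eqP; rewrite entry.
Qed.

Lemma conjdiag_intertwine n (U V W : 'M[C]_n) a b (f : R -> R) :
  U \is unitarymx -> V \is unitarymx ->
  conjdiag U a *m W = W *m conjdiag V b ->
  conjdiag U (map_mx f a) *m W = W *m conjdiag V (map_mx f b).
Proof.
move=> uU uV /conjdiag_intertwineP ab; apply/conjdiag_intertwineP => // i j.
have /orP[-> //|/eqP abij] := ab uU uV i j.
by rewrite [map_mx f a _ _]mxE [map_mx f b _ _]mxE abij eqxx orbT.
Qed.

Lemma mxfun_conjdiag n (U : 'M[C]_n) d f : U \is unitarymx ->
  mxfun f (conjdiag U d) = conjdiag U (map_mx f d).
Proof.
move=> uU; set A := conjdiag U d; have uP := spectral_unitarymx A.
have -> : mxfun f A =
    conjdiag (spectralmx A) (map_mx f (map_mx re (spectral_diag A))).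
  rewrite /mxfun (invmx_unitary uP) /conjdiag /rdiag.
  congr (_ *m diag_mx _ *m _).
  by apply/rowP => i; rewrite !mxE.
rewrite -[LHS]mulmx1 -[RHS]mul1mx; apply: conjdiag_intertwine => //.
by rewrite -hermsymmx_spectralE ?hermsymmx_conjdiag// mulmx1 mul1mx.
Qed.

Lemma mxfun_intertwine n (A B W : 'M[C]_n) f :
  A \is hermsymmx -> B \is hermsymmx -> A *m W = W *m B ->
  mxfun f A *m W = W *m mxfun f B.
Proof.
move=> /hermsymmx_spectral[U uU ->] /hermsymmx_spectral[V uV ->].
rewrite (mxfun_conjdiag _ _ uU) (mxfun_conjdiag _ _ uV).
exact: conjdiag_intertwine uU uV.
Qed.

Lemma mxpow_conjdiag n (U : 'M[C]_n) d t : U \is unitarymx ->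
  mxpow (conjdiag U d) t = conjdiag U (map_mx (@powR R ^~ t) d).
Proof. exact: mxfun_conjdiag. Qed.

End spectral_theorem.

Section powers.
Context {R : realType}.
Local Notation C := (Cx R).

Lemma posdef_mxpow n (A : 'M[C]_n) t : posdef A -> posdef (mxpow A t).
Proof.
move=> /posdef_spectral[U [d [uU -> d0]]]; rewrite (mxpow_conjdiag _ _ uU).
by apply: posdef_conjdiag => // i; rewrite mxE powR_gt0.
Qed.

Lemma hermsymmx_mxpow n (A : 'M[C]_n) t : posdef A -> mxpow A t \is hermsymmx.
Proof. by move=> pA; exact/posdef_herm/posdef_mxpow. Qed.

Lemma mxpowD n (A : 'M[C]_n) s t : posdef A ->
  mxpow A (s + t) = mxpow A s *m mxpow A t.
Proof.
move=> /posdef_spectral[U [d [uU -> d0]]]; rewrite !(mxpow_conjdiag _ _ uU).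
rewrite (conjdiagM _ _ uU).
congr conjdiag; apply/rowP => i; rewrite !mxE powRD//.
by apply/implyP => _; rewrite gt_eqF.
Qed.

Lemma mxpowr1 n (A : 'M[C]_n) : posdef A -> mxpow A 1 = A.
Proof.
move=> /posdef_spectral[U [d [uU -> d0]]]; rewrite !(mxpow_conjdiag _ _ uU).
by congr conjdiag; apply/rowP => i; rewrite mxE powRr1// ltW.
Qed.

Lemma mxpow1 n t : mxpow (1%:M : 'M[C]_n) t = 1%:M.
Proof.
have u1 := @unitarymx1 R n.
rewrite -(conjdiag_const 1 u1) (mxpow_conjdiag _ _ u1).
by rewrite map_const_mx powR1.
Qed.

Lemma mxpowr0 n (A : 'M[C]_n) : posdef A -> mxpow A 0 = 1%:M.
Proof.
move=> /posdef_spectral[U [d [uU -> d0]]]; rewrite !(mxpow_conjdiag _ _ uU).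
rewrite -(conjdiag_const 1 uU); congr conjdiag.
by apply/rowP => i; rewrite !mxE powRr0.
Qed.

Lemma mxpowM n (A : 'M[C]_n) s t : posdef A ->
  mxpow A (s * t) = mxpow (mxpow A s) t.
Proof.
move=> /posdef_spectral[U [d [uU -> d0]]]; rewrite !(mxpow_conjdiag _ _ uU).
by congr conjdiag; apply/rowP => i; rewrite !mxE powRrM.
Qed.

Lemma mxpowZ n (A : 'M[C]_n) (c : R) t : 0 <= c -> posdef A ->
  mxpow (c%:Cx *: A) t = (c `^ t)%:Cx *: mxpow A t.
Proof.
move=> c0 /posdef_spectral[U [d [uU -> d0]]].
rewrite -conjdiagZ !(mxpow_conjdiag _ _ uU) -conjdiagZ; congr conjdiag.
by apply/rowP => i; rewrite !mxE powRM// ltW.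
Qed.

Lemma mxpow_rdiag n (d : 'rV[R]_n) t :
  mxpow (rdiag d) t = rdiag (map_mx (@powR R ^~ t) d).
Proof. by rewrite -!conjdiag1 (mxpow_conjdiag _ _ (unitarymx1 n)). Qed.

Lemma mxpowN_mul n (A : 'M[C]_n) t : posdef A ->
  mxpow A (- t) *m mxpow A t = 1%:M.
Proof. by move=> pA; rewrite -(mxpowD _ _ pA) addNr (mxpowr0 pA). Qed.

Lemma mxpow_mulN n (A : 'M[C]_n) t : posdef A ->
  mxpow A t *m mxpow A (- t) = 1%:M.
Proof. by move=> pA; rewrite -(mxpowD _ _ pA) subrr (mxpowr0 pA). Qed.

Lemma mxpow_half n (A : 'M[C]_n) t : posdef A ->
  mxpow A (t / 2) *m mxpow A (t / 2) = mxpow A t.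
Proof. by move=> pA; rewrite -(mxpowD _ _ pA) -splitr. Qed.

Lemma posdef_mxpow_sandwich n (X A : 'M[C]_n) t : posdef X -> posdef A ->
  posdef (mxpow X t *m A *m mxpow X t).
Proof.
move=> pX; exact: (posdef_sandwich (hermsymmx_mxpow t pX) (mxpowN_mul t pX)).
Qed.

Lemma mxpow_intertwine n (A B W : 'M[C]_n) t : posdef A -> posdef B ->
  A *m W = W *m B -> mxpow A t *m W = W *m mxpow B t.
Proof. by move=> pA pB; apply: mxfun_intertwine; exact: posdef_herm. Qed.

Lemma mxpow_inverse n (E F : 'M[C]_n) t : posdef E -> F *m E = 1%:M ->
  mxpow F t = mxpow E (- t).
Proof.
move=> pE FE; have -> : F = mxpow E (- 1).
  by rewrite -[F]mulmx1 -(mxpow_mulN 1 pE) (mxpowr1 pE) mulmxA FE mul1mx.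
by rewrite -(mxpowM _ _ pE) mulN1r.
Qed.

End powers.

(** * The Loewner-Heinz inequality *)

Section loewner_heinz.
Context {R : realType}.
Local Notation C := (Cx R).

(* If [(Q - P) v = d v] then [<(Q^2 - P^2) v, v> = d <(P + Q) v, v>], so a
   negative eigenvalue [d] is excluded. *)
Lemma fle_sqr n (P Q : 'M[C]_n) : posdef P -> posdef Q ->
  P *m P ⪯ Q *m Q -> P ⪯ Q.
Proof.
move=> pP pQ PQ.
have hD : Q - P \is hermsymmx by apply: hermsymmxB; exact: posdef_herm.
suff eig_ge0 i : 0 <= eigvals (Q - P) 0 i.
  have [U uU DE] := hermsymmx_spectral hD => v.
  rewrite -subr_ge0 -rformB DE rform_conjdiag; apply: sumr_ge0 => i _.
  by rewrite mulr_ge0 ?sqmod_ge0.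
rewrite leNgt; apply/negP => eig_lt0.
have [v v1 Dv] := eigvals_eigenvector i hD.
have v0 : v != 0 by rewrite -sqnorm_gt0 v1 ltr01.
have sqrB : Q *m Q - P *m P = (Q - P) *m Q + P *m (Q - P).
  by rewrite mulmxBl mulmxBr addrA subrK.
have := PQ v; rewrite -subr_ge0 -rformB sqrB rformD.
rewrite (rform_eigenl _ hD Dv) (rform_eigenr _ Dv) -mulrDr nmulr_rge0// leNgt.
by move=> /negP; apply; apply: addr_gt0; exact: posdef_rform_gt0.
Qed.

(* [(A' - B') A (A' - B') >= 0] for the inverses [A'] and [B'], while
   [B' A B' <= B' B B' = B']. *)
Lemma fle_inverse n (A B A' B' : 'M[C]_n) : posdef A ->
  A' \is hermsymmx -> B' \is hermsymmx -> A' *m A = 1%:M -> B' *m B = 1%:M ->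
  A ⪯ B -> B' ⪯ A'.
Proof.
move=> pA hA' hB' A'A B'B AB v; have AA' := mulmx1C A'A.
have square : (A' - B') *m A *m (A' - B') = A' - B' - B' + B' *m A *m B'.
  rewrite mulmxBl A'A mulmxBl mul1mx mulmxBr -(mulmxA _ A A') AA' mulmx1.
  by rewrite opprB addrA addrAC.
have := posdef_rform_ge0 ((A' - B') *m v) pA.
rewrite -(rform_sandwich _ _ (hermsymmxB hA' hB')) square.
have := fle_sandwich hB' AB v; rewrite B'B mul1mx !(rformD, rformN).
move: (rform A' v) (rform B' v) (rform _ v) => a b c; lra.
Qed.

Lemma mulmx_sandwichK n (K L A : 'M[C]_n) : L *m K = 1%:M ->
  L *m (K *m A *m K) *m L = A.
Proof.
move=> LK; have KL := mulmx1C LK.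
by rewrite !mulmxA LK mul1mx -mulmxA KL mulmx1.
Qed.

(* [P S P <= Q S Q] compares the squares of [S^(1/2) P S^(1/2)] and
   [S^(1/2) Q S^(1/2)]. *)
Lemma fle_riccati n (S P Q : 'M[C]_n) : posdef S -> posdef P -> posdef Q ->
  P *m S *m P ⪯ Q *m S *m Q -> P ⪯ Q.
Proof.
move=> pS pP pQ PQ.
have hK : mxpow S 2^-1 \is hermsymmx := hermsymmx_mxpow _ pS.
have hL : mxpow S (- 2^-1) \is hermsymmx := hermsymmx_mxpow _ pS.
have pKPK := posdef_mxpow_sandwich 2^-1 pS pP.
have pKQK := posdef_mxpow_sandwich 2^-1 pS pQ.
have KK := mxpow_half 1 pS; rewrite mul1r (mxpowr1 pS) in KK.
have LK := mxpowN_mul 2^-1 pS.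
move: (mxpow S 2^-1) (mxpow S (- 2^-1)) hK hL pKPK pKQK KK LK.
move=> K L hK hL pKPK pKQK KK LK.
rewrite -[P](mulmx_sandwichK _ LK) -[Q](mulmx_sandwichK _ LK).
apply: (fle_sandwich hL); apply: (fle_sqr pKPK pKQK).
have sqrK X : K *m X *m K *m (K *m X *m K) = K *m (X *m S *m X) *m K.
  by rewrite -KK !mulmxA.
by rewrite (sqrK P) (sqrK Q); exact: fle_sandwich.
Qed.

(* With [m = (s + t) / 2]:
   [A^m A^-s A^m = A^t <= B^t = B^m B^-s B^m <= B^m A^-s B^m]. *)
Lemma fle_mxpow_midpoint n (A B : 'M[C]_n) s t : posdef A -> posdef B ->
  mxpow A s ⪯ mxpow B s -> mxpow A t ⪯ mxpow B t ->
  mxpow A ((s + t) / 2) ⪯ mxpow B ((s + t) / 2).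
Proof.
move=> pA pB AsBs AtBt; set m := (s + t) / 2.
have mxpow_tE (X : 'M[C]_n) : posdef X ->
    mxpow X t = mxpow X m *m mxpow X (- s) *m mxpow X m.
  by move=> pX; rewrite -!(mxpowD _ _ pX); congr mxpow; rewrite /m; field.
have pAs : posdef (mxpow A (- s)) := posdef_mxpow _ pA.
apply: (fle_riccati pAs (posdef_mxpow m pA) (posdef_mxpow m pB)).
rewrite -[X in X ⪯ _](mxpow_tE _ pA); apply: (fle_trans AtBt).
rewrite [X in X ⪯ _](mxpow_tE _ pB).
apply: fle_sandwich; first exact: hermsymmx_mxpow.
apply: (fle_inverse (posdef_mxpow s pA) _ _ _ _ AsBs).
- exact: hermsymmx_mxpow.
- exact: hermsymmx_mxpow.
- exact: mxpowN_mul.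
- exact: mxpowN_mul.
Qed.

Lemma fle_mxpow_dyadic n (A B : 'M[C]_n) p k : posdef A -> posdef B -> A ⪯ B ->
  (k <= 2 ^ p)%N -> mxpow A (k%:R / 2 ^+ p) ⪯ mxpow B (k%:R / 2 ^+ p).
Proof.
move=> pA pB AB; elim: p k => [|p IHp] k kp.
  have -> : k%:R / 2 ^+ 0 = k%:R :> R by rewrite expr0 divr1.
  move: kp; rewrite expn0 leq_eqVlt ltnS leqn0 => /orP[]/eqP->.
    by rewrite (mxpowr1 pA) (mxpowr1 pB).
  by rewrite (mxpowr0 pA) (mxpowr0 pB).
have p0 : (2 ^+ p : R) != 0 by rewrite expf_neq0.
have -> : k%:R / 2 ^+ p.+1 =
    ((k./2)%:R / 2 ^+ p + (uphalf k)%:R / 2 ^+ p) / 2 :> R.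
  rewrite -{1}(odd_double_half k) uphalf_half -addnn !natrD exprS.
  by field.
have uphalf_kp : (uphalf k <= 2 ^ p)%N.
  by rewrite leq_uphalf_double -mul2n -expnS.
apply: (fle_mxpow_midpoint pA pB); apply: IHp => //.
by rewrite (leq_trans _ uphalf_kp)// uphalf_half leq_addl.
Qed.

Lemma rform_mxpow_continuous n (A : 'M[C]_n) v : posdef A ->
  continuous (fun s => rform (mxpow A s) v).
Proof.
move=> /posdef_spectral[U [d [uU -> d0]]] s.
rewrite /continuous_at (mxpow_conjdiag _ _ uU) rform_conjdiag.
under eq_fun do rewrite (mxpow_conjdiag _ _ uU) rform_conjdiag.
apply: cvg_big => [|i _]; first exact: add_continuous.
apply: cvgMr_tmp; rewrite mxE; under eq_fun do rewrite mxE.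
rewrite /powR gt_eqF//.
apply: (@continuous_cvg _ _ _ _ _ (fun u => u * ln (d 0 i)) expR).
  exact: continuous_expR.
by apply: cvgMr_tmp; exact: cvg_id.
Qed.

Lemma dyadic_approximation (s : R) : 0 <= s <= 1 ->
  exists2 k : nat -> nat, forall p, (k p <= 2 ^ p)%N &
    (k p)%:R / 2 ^+ p @[p --> \oo] --> s.
Proof.
move=> /andP[s0 s1]; exists (fun p => Num.truncn (s * 2 ^+ p)) => [p|].
  have /andP[ks _] := truncn_itv (mulr_ge0 s0 (exprn_ge0 p (ler0n R 2))).
  by rewrite -(ler_nat R) natrX (le_trans ks)// ler_piMl// exprn_ge0.
apply: (@squeeze_cvgr _ _ _ _ (fun p => s - geometric 1 2^-1 p) (cst s)).
- near=> p; have p0 : 0 < 2 ^+ p :> R by rewrite exprn_gt0.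
  have /andP[ks sk] := truncn_itv (mulr_ge0 s0 (ltW p0)).
  rewrite /geometric /= ler_pdivrMr// ks andbT ler_pdivlMr// mulrBl mul1r.
  by rewrite -exprMn mulVf// expr1n lerBlDr natr1 ltW.
- rewrite -[X in _ --> X]subr0; apply: cvgB; first exact: cvg_cst.
  by apply: cvg_geometric; rewrite ger0_norm// invf_lt1// ltr1n.
- exact: cvg_cst.
Unshelve. all: by end_near. Qed.

Lemma fle_mxpow n (A B : 'M[C]_n) (s : R) : posdef A -> posdef B ->
  0 <= s <= 1 -> A ⪯ B -> mxpow A s ⪯ mxpow B s.
Proof.
move=> pA pB /dyadic_approximation[k kp ks] AB v.
have cvg_form X : posdef X ->
    rform (mxpow X ((k p)%:R / 2 ^+ p)) v @[p --> \oo] --> rform (mxpow X s) v.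
  move=> pX; apply: (cvg_comp _ (fun u => rform (mxpow X u) v) ks).
  exact: rform_mxpow_continuous.
apply: (ler_cvg_to (cvg_form A pA) (cvg_form B pB)).
by near=> p; exact: fle_mxpow_dyadic.
Unshelve. all: by end_near. Qed.

End loewner_heinz.

(** * Weighted geometric means *)

Section weighted_geometric_mean.
Context {R : realType}.
Local Notation C := (Cx R).
Implicit Types r c : R.

Lemma posdef_wgeomean n r (X A : 'M[C]_n) :
  posdef X -> posdef A -> posdef (wgeomean r X A).
Proof.
move=> pX pA; apply: (posdef_mxpow_sandwich _ pX); apply: posdef_mxpow.
exact: posdef_mxpow_sandwich pX pA.
Qed.

Lemma fle_wgeomeanr n r (X A B : 'M[C]_n) : 0 <= r <= 1 ->
  posdef X -> posdef A -> posdef B -> A ⪯ B -> wgeomean r X A ⪯ wgeomean r X B.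
Proof.
move=> r01 pX pA pB AB; apply: fle_sandwich; first exact: hermsymmx_mxpow.
apply: (fle_mxpow _ _ r01).
- exact: posdef_mxpow_sandwich pX pA.
- exact: posdef_mxpow_sandwich pX pB.
by apply: fle_sandwich AB; exact: hermsymmx_mxpow.
Qed.

(* With [Z = A^(1/2) X^(-1/2)], both sides are expressed through the functional
   calculi of [Z^* Z] and [Z Z^*], which [Z] intertwines. *)
Lemma wgeomean_swap n r (X A : 'M[C]_n) : posdef X -> posdef A ->
  wgeomean r X A = wgeomean (1 - r) A X.
Proof.
move=> pX pA; rewrite /wgeomean.
have HH' := mxpow_mulN 2^-1 pX; have H'H := mxpowN_mul 2^-1 pX.
have K'K := mxpowN_mul 2^-1 pA; have KK := mxpow_half 1 pA.
have H'H' := mxpow_half (- 1) pX; have XX' := mxpow_mulN 1 pX.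
have pE := posdef_mxpow_sandwich 2^-1 pA (posdef_mxpow (- 1) pX).
have pB := posdef_mxpow_sandwich (- 2^-1) pX pA.
rewrite mulNr !mul1r (mxpowr1 pA) (mxpowr1 pX) in KK H'H' XX'.
move: (mxpow X 2^-1) (mxpow X (- 2^-1)) (mxpow X (- 1)) HH' H'H H'H' XX' pE pB.
move: (mxpow A 2^-1) (mxpow A (- 2^-1)) K'K KK.
move=> K K' K'K KK H H' X' HH' H'H H'H' XX' pE pB.
have FE : K' *m X *m K' *m (K *m X' *m K) = 1%:M.
  by rewrite !mulmxA -(mulmxA _ K' K) K'K mulmx1 -(mulmxA _ X) XX' mulmx1.
have EZ : K *m X' *m K *m (K *m H') = K *m H' *m (H' *m A *m H').
  by rewrite -KK -H'H' !mulmxA.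
have KZ : K *m (K *m H') = H *m (H' *m A *m H').
  by rewrite mulmxA KK !mulmxA HH' mul1mx.
rewrite (mxpow_inverse _ pE FE) opprB.
move: (K *m X' *m K) (H' *m A *m H') pE pB EZ KZ {FE} => E B pE pB EZ KZ.
have BrE : B *m mxpow B (r - 1) = mxpow B r.
  by rewrite -[X in X *m _](mxpowr1 pB) -(mxpowD _ _ pB) addrC subrK.
have := mxpow_intertwine (r - 1) pE pB EZ.
move: (mxpow E _) (mxpow B _) (mxpow B r) BrE => Er1 Br1 Br BrE EZr.
transitivity (K *m (Er1 *m (K *m H')) *m H).
  by rewrite EZr (mulmxA K) KZ -(mulmxA H B) BrE.
by rewrite -!mulmxA H'H mulmx1.
Qed.

Lemma fle_wgeomeanl n r (X Y A : 'M[C]_n) : 0 <= r <= 1 ->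
  posdef X -> posdef Y -> posdef A -> X ⪯ Y -> wgeomean r X A ⪯ wgeomean r Y A.
Proof.
move=> r01 pX pY pA XY; rewrite (wgeomean_swap _ pX pA) (wgeomean_swap _ pY pA).
by apply: fle_wgeomeanr => //; lra.
Qed.

Lemma wgeomeanZr n r c (X A : 'M[C]_n) : 0 < c -> posdef X -> posdef A ->
  wgeomean r X (c%:Cx *: A) = (c `^ r)%:Cx *: wgeomean r X A.
Proof.
move=> c0 pX pA.
have scale_sandwich (z : C) (K B : 'M[C]_n) :
    K *m (z *: B) *m K = z *: (K *m B *m K).
  by rewrite -scalemxAr -scalemxAl.
rewrite /wgeomean (scale_sandwich _ (mxpow X (- 2^-1))).
rewrite (mxpowZ _ (ltW c0) (posdef_mxpow_sandwich _ pX pA)).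
exact: scale_sandwich.
Qed.

Lemma wgeomeanZl n r c (X A : 'M[C]_n) : 0 < c -> posdef X -> posdef A ->
  wgeomean r (c%:Cx *: X) A = (c `^ (1 - r))%:Cx *: wgeomean r X A.
Proof.
move=> c0 pX pA; rewrite (wgeomean_swap _ pX pA).
by rewrite (wgeomean_swap _ (posdefZ c0 pX) pA) (wgeomeanZr _ c0 pA pX).
Qed.

Lemma wgeomean_id n r (X : 'M[C]_n) : posdef X -> wgeomean r X X = X.
Proof.
move=> pX; have HH := mxpow_half 1 pX; have HH' := mxpow_mulN 2^-1 pX.
have H'H := mxpowN_mul 2^-1 pX; rewrite mul1r (mxpowr1 pX) in HH.
rewrite /wgeomean; move: (mxpow X 2^-1) (mxpow X (- 2^-1)) HH HH' H'H.
move=> H H' HH HH' H'H.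
have -> : H' *m X *m H' = 1%:M by rewrite -HH !mulmxA H'H mul1mx.
by rewrite mxpow1 mulmx1.
Qed.

Lemma powR_wgeomean r (x a : R) : 0 < x -> 0 <= a ->
  x `^ 2^-1 * (x `^ (- 2^-1) * a * x `^ (- 2^-1)) `^ r * x `^ 2^-1 =
    x `^ (1 - r) * a `^ r.
Proof.
move=> x0 a0; rewrite !powRM ?powR_ge0 ?mulr_ge0 ?powR_ge0// -!powRrM.
have xD s t : x `^ s * x `^ t = x `^ (s + t).
  by rewrite powRD//; apply/implyP => _; rewrite gt_eqF.
rewrite [LHS](_ : _ = x `^ 2^-1 * x `^ (- 2^-1 * r) *
  x `^ (- 2^-1 * r) * x `^ 2^-1 * a `^ r); last by ring.
by rewrite !xD; congr (_ `^ _ * _); lra.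
Qed.

Lemma wgeomean_rdiag n r (x a : 'rV[R]_n) :
  (forall i, 0 < x 0 i) -> (forall i, 0 < a 0 i) ->
  wgeomean r (rdiag x) (rdiag a) =
    rdiag (\row_i (x 0 i `^ (1 - r) * a 0 i `^ r)).
Proof.
move=> x0 a0; rewrite /wgeomean !mxpow_rdiag !rdiagM mxpow_rdiag !rdiagM.
by congr rdiag; apply/rowP => i; rewrite !mxE powR_wgeomean// ltW.
Qed.

End weighted_geometric_mean.

(** * Log-majorization and weak majorization of sequences *)

Section scalar_inequalities.
Context {R : realType}.
Implicit Types (r x y : R) (N K k : nat).

Lemma ler_mul_lt1 (x y : R) : (forall c, 0 < c < 1 -> c * x <= y) -> x <= y.
Proof.
move=> xy; rewrite -[x]mul1r.
have id_cvg : c @[c --> (1 : R)^'-] --> (1 : R).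
  by apply: cvg_at_left_filter; exact: cvg_id.
apply: ler_cvg_to (cvgMr_tmp id_cvg) (cvg_cst _) _.
near=> c; apply: xy; apply/andP; split; near: c.
  exact: nbhs_left_gt.
exact: nbhs_left_lt.
Unshelve. all: by end_near. Qed.

Lemma powR_young x y r : 0 < x -> 0 < y -> 0 <= r <= 1 ->
  x `^ (1 - r) * y `^ r <= (1 - r) * x + r * y.
Proof.
move=> x0 y0 /andP[r0 r1].
have xy0 : 0 < (1 - r) * x + r * y.
  by have := @convR_gt0 _ y x (Itv01 r0 r1) y0 x0; rewrite convRE addrC.
rewrite -ler_ln ?posrE ?mulr_gt0 ?powR_gt0// lnM ?posrE ?powR_gt0// !ln_powR.
rewrite addrC [(1 - r) * x + _]addrC.
exact: (@concave_ln _ (Itv01 r0 r1) y x y0 x0).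
Qed.

Lemma hoelder_sum_powR (I : finType) (w p : I -> R) r : 0 <= r <= 1 ->
  (forall i, 0 <= w i) -> (forall i, 0 < p i) -> 0 < \sum_i w i ->
  \sum_i w i * p i `^ r <= (\sum_i w i) `^ (1 - r) * (\sum_i w i * p i) `^ r.
Proof.
move=> r01 w0 p0; set W := \sum_i w i => W0; set P := \sum_i w i * p i.
have P0 : 0 < P.
  have wp0 i : 0 <= w i * p i by rewrite mulr_ge0// ltW.
  rewrite lt_neqAle sumr_ge0 ?andbT 1?eq_sym//.
  apply: contraTneq W0 => /psumr_eq0P wp.
  rewrite -leNgt le_eqVlt (_ : W = 0) ?eqxx//; apply: big1 => i _.
  have /eqP := wp (fun i _ => wp0 i) i isT.
  by rewrite mulf_eq0 (gt_eqF (p0 i)) orbF => /eqP.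
have m0 : 0 < P / W by rewrite divr_gt0.
have powWP : (P / W) `^ (1 - r) * (W `^ (1 - r) * P `^ r) = P.
  rewrite mulrA -powRM ?divfK ?gt_eqF ?ltW// -powRD ?subrK ?powRr1 ?ltW//.
  by rewrite gt_eqF ?implybT.
have sumE : P = \sum_i w i * ((1 - r) * (P / W) + r * p i).
  rewrite (eq_bigr (fun i => w i * ((1 - r) * (P / W)) + r * (w i * p i))).
    rewrite big_split /= -mulr_suml -mulr_sumr -/W -/P.
    by field; exact: lt0r_neq0.
  by move=> i _; ring.
rewrite -(ler_pM2l (powR_gt0 (1 - r) m0)) powWP [leRHS]sumE.
rewrite mulr_sumr; apply: ler_sum => i _; rewrite mulrCA.
by apply: ler_wpM2l => //; exact: powR_young.
Qed.

Lemma prod_powR (I : finType) (P : pred I) (x : I -> R) r :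
  (forall i, 0 <= x i) ->
  \prod_(i | P i) x i `^ r = (\prod_(i | P i) x i) `^ r.
Proof.
move=> x0; suff [] : \prod_(i | P i) x i `^ r = (\prod_(i | P i) x i) `^ r /\
    0 <= \prod_(i | P i) x i by [].
elim/big_rec2: _ => [|i y z _ [-> y0]]; first by rewrite powR1.
by rewrite powRM// mulr_ge0.
Qed.

Lemma sum_ln (I : finType) (P : pred I) (x : I -> R) : (forall i, 0 < x i) ->
  \sum_(i | P i) ln (x i) = ln (\prod_(i | P i) x i).
Proof.
move=> x0; rewrite -[LHS]expRK expR_sum; congr ln.
by apply: eq_bigr => i _; rewrite lnK// posrE.
Qed.

Lemma big_ord_ltS (S : Type) (idx : S) (op : Monoid.com_law idx) N k
    (kN : (k < N)%N) (F : 'I_N -> S) :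
  \big[op/idx]_(i < N | (i < k.+1)%N) F i =
    op (\big[op/idx]_(i < N | (i < k)%N) F i) (F (Ordinal kN)).
Proof.
rewrite (bigD1 (Ordinal kN))//= Monoid.mulmC; congr (op _ _).
apply: eq_bigl => i; rewrite ltnS -(inj_eq val_inj) /= (ltn_neqAle i k).
by rewrite andbC.
Qed.

Lemma abel_sum_ge0 N K (y a : 'I_N -> R) :
  (forall i, 0 <= y i) -> (forall i j : 'I_N, (i <= j)%N -> y j <= y i) ->
  (forall k, (k <= K)%N -> 0 <= \sum_(i < N | (i < k)%N) a i) ->
  (K <= N)%N -> 0 <= \sum_(i < N | (i < K)%N) y i * a i.
Proof.
move=> y0 y_noninc a_ge0 KN.
have partial k (kN : (k < N)%N) : (k < K)%N ->
    y (Ordinal kN) * \sum_(i < N | (i < k.+1)%N) a i <=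
      \sum_(i < N | (i < k.+1)%N) y i * a i.
  elim: k kN => [|k IHk] kN kK.
    by rewrite !(big_ord_ltS _ kN) !big_pred0//= !add0r.
  have kN' := ltnW kN; apply: le_trans (_ : _ <= y (Ordinal kN') *
    (\sum_(i < N | (i < k.+1)%N) a i) + y (Ordinal kN) * a (Ordinal kN)) _.
    rewrite (big_ord_ltS _ kN) mulrDr lerD2r ler_wpM2r ?y_noninc//.
    exact/a_ge0/ltnW.
  by rewrite [leRHS](big_ord_ltS _ kN) lerD2r IHk// ltnW.
case: K KN a_ge0 partial => [|k] kN a_ge0 partial; first by rewrite big_pred0.
by apply: le_trans (partial k kN _) => //; rewrite mulr_ge0// a_ge0.
Qed.

Lemma log_majorization_weak N K (y z : 'I_N -> R) :
  (forall i, 0 < y i) -> (forall i, 0 < z i) ->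
  (forall i j : 'I_N, (i <= j)%N -> y j <= y i) ->
  (forall k, (k <= N)%N ->
    \prod_(i < N | (i < k)%N) y i <= \prod_(i < N | (i < k)%N) z i) ->
  (K <= N)%N ->
  \sum_(i < N | (i < K)%N) y i <= \sum_(i < N | (i < K)%N) z i.
Proof.
move=> y0 z0 y_noninc yz KN.
have weighted_ln_ge0 :
    0 <= \sum_(i < N | (i < K)%N) y i * (ln (z i) - ln (y i)).
  apply: abel_sum_ge0 => // [i|k kK]; first exact: ltW.
  rewrite sumrB subr_ge0 !sum_ln// ler_ln ?posrE ?prodr_gt0// yz//.
  exact: leq_trans kK KN.
rewrite -subr_ge0 -sumrB; apply: (le_trans weighted_ln_ge0).
apply: ler_sum => i _.
have zy0 : 0 < z i / y i by rewrite divr_gt0.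
rewrite -ln_div ?posrE// (_ : z i - y i = y i * (z i / y i - 1)); last first.
  by field; exact: lt0r_neq0.
apply: ler_wpM2l; first exact: ltW.
by have := expR_ge1Dx (ln (z i / y i)); rewrite lnK ?posrE//; lra.
Qed.

Lemma sum_weighted_le_top N (d w : 'I_N -> R) k :
  (forall i j : 'I_N, (i <= j)%N -> d j <= d i) ->
  (forall i, 0 <= w i <= 1) -> (k <= N)%N -> \sum_i w i = k%:R ->
  \sum_i d i * w i <= \sum_(i < N | (i < k)%N) d i.
Proof.
move=> d_noninc w01; case: k => [|k] kN wk.
  have w0 i : true -> 0 <= w i by have /andP[] := w01 i.
  rewrite [leRHS]big_pred0// big1// => i _.
  by rewrite (psumr_eq0P w0 wk)// mulr0.
set t := d (Ordinal kN); pose top (i : 'I_N) : R := (i < k.+1)%N%:R.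
have topE : \sum_i t * (top i - w i) = 0.
  rewrite -mulr_sumr sumrB wk -natr_sum -big_mkcond /= (big_ord_narrow kN).
  by rewrite sum1_card card_ord subrr mulr0.
rewrite [leRHS]big_mkcond /= -subr_ge0 -sumrB -[leLHS]topE.
apply: ler_sum => i _.
rewrite /top; have /andP[w0 w1] := w01 i; case: ltnP => ik.
  by rewrite -{1}[d i]mulr1 -mulrBr ler_wpM2r ?subr_ge0// d_noninc.
by rewrite !sub0r mulrN lerN2 ler_wpM2r// d_noninc// ltnW.
Qed.

Lemma prod_inj_le_top N k (d : 'I_N -> R) (f : 'I_k -> 'I_N) :
  (forall i, 0 < d i) -> (forall i j : 'I_N, (i <= j)%N -> d j <= d i) ->
  injective f -> \prod_i d (f i) <= \prod_(i < N | (i < k)%N) d i.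
Proof.
move=> d0 d_noninc f_inj.
have kN : (k <= N)%N by rewrite -[k]card_ord -[N]card_ord (leq_card f).
pose w (j : 'I_N) : R := (j \in codom f)%:R.
have sum_comp (F : 'I_N -> R) : \sum_i F (f i) = \sum_j F j * w j.
  transitivity (\sum_(j <- codom f) F j); first by rewrite big_image.
  rewrite big_uniq /=; last exact/injectiveP.
  by rewrite big_mkcond; apply: eq_bigr => j _; rewrite -mulrb mulr_natr.
rewrite -ler_ln ?posrE ?prodr_gt0// -!sum_ln// (sum_comp (fun i => ln (d i))).
apply: sum_weighted_le_top kN _ => [i j ij|i|].
- by rewrite ler_ln ?posrE// d_noninc.
- by rewrite /w; case: (_ \in _); rewrite ?lexx ?ler01.
- under eq_bigr do rewrite -[w _]mul1r.
  by rewrite -(sum_comp (fun=> 1)) sumr_const card_ord.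
Qed.

End scalar_inequalities.

(** * Cauchy-Binet formula and Ky Fan principle *)

Section cauchy_binet.
Context {R : comNzRingType}.

Lemma det_mulmx_rowsub k N (A : 'M[R]_(k, N)) (B : 'M[R]_(N, k)) :
  \det (A *m B) =
    \sum_(f : {ffun 'I_k -> 'I_N}) (\prod_i A i (f i)) * \det (rowsub f B).
Proof.
rewrite /determinant; under eq_bigr => s _.
  under eq_bigr => i _ do rewrite mxE.
  rewrite (bigA_distr_bigA (fun i l => A i l * B l (s i))) mulr_sumr /=.
  over.
rewrite exchange_big /=; apply: eq_bigr => f _; rewrite mulr_sumr.
apply: eq_bigr => s _; rewrite big_split /= mulrCA; congr (_ * (_ * _)).
by apply: eq_bigr => i _; rewrite mxE.
Qed.

(* The index maps [f] are not required to be increasing, so each pair of minors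
   is counted [k!] times. *)
Lemma Cauchy_Binet k N (A : 'M[R]_(k, N)) (B : 'M[R]_(N, k)) :
  k`!%:R * \det (A *m B) =
    \sum_(f : {ffun 'I_k -> 'I_N}) \det (colsub f A) * \det (rowsub f B).
Proof.
pose permute (f : {ffun 'I_k -> 'I_N}) (s : 'S_k) := [ffun i => f (s i)].
have permute_inj s : injective (permute^~ s).
  move=> f g /ffunP fg; apply/ffunP => i; have := fg ((s^-1)%g i).
  by rewrite !ffunE permKV.
have det_rowsub_permute f s :
    \det (rowsub (permute f s) B) = (-1) ^+ s * \det (rowsub f B).
  have -> : rowsub (permute f s) B = row_perm s (rowsub f B).
    by apply/matrixP => i j; rewrite !mxE ffunE.
  by rewrite row_permE det_mulmx det_perm.
have permutedE (s : 'S_k) : \det (A *m B) =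
    \sum_f (\prod_i A i (permute f s i)) * ((-1) ^+ s * \det (rowsub f B)).
  rewrite det_mulmx_rowsub (reindex_inj (permute_inj s)) /=.
  by apply: eq_bigr => f _; rewrite det_rowsub_permute.
transitivity (\sum_(s : 'S_k) \det (A *m B)).
  by rewrite sumr_const card_Sn mulr_natl.
rewrite (eq_bigr _ (fun s _ => permutedE s)) exchange_big /=.
apply: eq_bigr => f _; rewrite mulr_suml.
apply: eq_bigr => s _; rewrite mulrA [_ * (-1) ^+ s]mulrC; congr (_ * _ * _).
by apply: eq_bigr => i _; rewrite !mxE ffunE.
Qed.

End cauchy_binet.

Definition rdet {R : realType} {n} (A : 'M[Cx R]_n) : R := re (\det A).

Definition minor_weight {R : realType} {N k} (W : 'M[Cx R]_(N, k))
    (f : {ffun 'I_k -> 'I_N}) : R :=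
  k`!%:R^-1 * sqmod (\det (rowsub f W)).

Section compressions.
Context {R : realType}.
Local Notation C := (Cx R).

Lemma rdet_rdiag n (d : 'rV[R]_n) : rdet (rdiag d) = \prod_i d 0 i.
Proof.
rewrite /rdet det_diag (eq_bigr (fun i => (d 0 i)%:Cx)) => [|i _].
  by rewrite -rmorph_prod re_cplx.
by rewrite mxE.
Qed.

Lemma rdet_conjdiag N k (W : 'M[C]_(N, k)) (d : 'rV[R]_N) :
  rdet (conjdiag W d) = \sum_f minor_weight W f * \prod_i d 0 (f i).
Proof.
have k0 : (k`!%:R : R) != 0 by rewrite pnatr_eq0 -lt0n fact_gt0.
apply: (mulfI k0); rewrite mulr_sumr /rdet -re_mulCx rmorph_nat.
rewrite Cauchy_Binet raddf_sum; apply: eq_bigr => f _.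
rewrite /minor_weight !mulrA divff// mul1r.
have -> : colsub f (W^t* *m rdiag d) =
    (rowsub f W)^t* *m rdiag (\row_i d 0 (f i)).
  by apply/matrixP => i j; rewrite [LHS]mxE /rdiag !mul_mx_diag !mxE.
rewrite det_mulmx det_map_mx det_tr mulrAC conjM_sqmod /= re_mulCx.
congr (_ * _); rewrite -/(rdet _) rdet_rdiag.
by apply: eq_bigr => i _; rewrite mxE.
Qed.

Lemma minor_weight_ge0 N k (W : 'M[C]_(N, k)) f : 0 <= minor_weight W f.
Proof. by rewrite mulr_ge0 ?sqmod_ge0// invr_ge0. Qed.

Lemma sum_minor_weight N k (W : 'M[C]_(N, k)) :
  \sum_f minor_weight W f = rdet (W^t* *m W).
Proof.
rewrite -conjdiag_const1 rdet_conjdiag; apply: eq_bigr => f _.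
by rewrite big1 ?mulr1// => i _; rewrite mxE.
Qed.

Lemma minor_weight_eq0 N k (W : 'M[C]_(N, k)) (f : {ffun 'I_k -> 'I_N}) :
  ~~ injectiveb f -> minor_weight W f = 0.
Proof.
move=> /injectivePn[i [j ij fij]].
have det0 : \det (rowsub f W) = 0.
  by apply: (determinant_alternate ij) => l; rewrite !mxE fij.
by apply/eqP; rewrite mulf_eq0 sqmod_eq0 det0 eqxx orbT.
Qed.

Lemma rdet_conjdiag_le_top N k (W : 'M[C]_(N, k)) (d : 'rV[R]_N) :
  (forall i, 0 < d 0 i) -> (forall i j : 'I_N, (i <= j)%N -> d 0 j <= d 0 i) ->
  W^t* *m W = 1%:M ->
  rdet (conjdiag W d) <= \prod_(i < N | (i < k)%N) d 0 i.
Proof.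
move=> d0 d_noninc W1; rewrite rdet_conjdiag.
have sum1 : \sum_f minor_weight W f = 1.
  by rewrite sum_minor_weight W1 /rdet det1.
rewrite -[leRHS]mul1r -[X in _ <= X * _]sum1 mulr_suml; apply: ler_sum => f _.
have [f_inj|f_ninj] := boolP (injectiveb f); last first.
  by rewrite (minor_weight_eq0 _ f_ninj) !mul0r.
apply: ler_wpM2l; first exact: minor_weight_ge0.
exact: (prod_inj_le_top d0 d_noninc (injectiveP _ f_inj)).
Qed.

Lemma rdet_gt0 n (A : 'M[C]_n) : posdef A -> 0 < rdet A.
Proof.
move=> /posdef_spectral[U [d [uU -> d0]]].
have -> : rdet (conjdiag U d) = rdet (rdiag d).
  congr re; rewrite /conjdiag !det_mulmx mulrAC -det_mulmx.
  by rewrite (unitarymx_adj uU) det1 mul1r.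
by rewrite rdet_rdiag prodr_gt0.
Qed.

Lemma rdet_wgeomean_le N k r (X A : 'M[C]_N) (V : 'M[C]_(N, k)) :
  0 <= r <= 1 -> posdef X -> posdef A -> V^t* *m V = 1%:M ->
  rdet (V^t* *m wgeomean r X A *m V) <=
    rdet (V^t* *m X *m V) `^ (1 - r) * rdet (V^t* *m A *m V) `^ r.
Proof.
move=> r01 pX pA V1; have dX0 := rdet_gt0 (posdef_conj V1 pX).
have pB := posdef_mxpow_sandwich (- 2^-1) pX pA.
have [U [b [uU bE b0]]] := posdef_spectral pB.
have hH := hermsymmx_mxpow 2^-1 pX.
have AE := mulmx_sandwichK A (mxpow_mulN 2^-1 pX).
have XE := mxpow_half 1 pX; rewrite mul1r (mxpowr1 pX) in XE.
rewrite /wgeomean bE (mxpow_conjdiag _ _ uU); rewrite bE in AE.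
move: (mxpow X 2^-1) hH AE XE => H hH AE XE.
have compressE d :
    V^t* *m (H *m conjdiag U d *m H) *m V = conjdiag (U *m (H *m V)) d.
  by rewrite -conj_conjdiag adjM (hermsymmxP _ hH) !mulmxA.
have XWE : rdet (V^t* *m X *m V) = \sum_f minor_weight (U *m (H *m V)) f.
  rewrite sum_minor_weight -conjdiag_const1 -compressE (conjdiag_const _ uU).
  by rewrite mulmx1 XE.
have AWE : V^t* *m A *m V = conjdiag (U *m (H *m V)) b.
  by rewrite -AE compressE.
rewrite compressE AWE; rewrite XWE in dX0 *.
move: (U *m (H *m V)) dX0 {compressE XWE AWE} => W dX0.
rewrite (rdet_conjdiag W b) (rdet_conjdiag W (map_mx _ b)).
under eq_bigr => f _.
  rewrite (eq_bigr (fun i => b 0 (f i) `^ r)) => [|i _]; last by rewrite mxE.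
  rewrite prod_powR => [|i]; last exact: ltW.
  over.
apply: hoelder_sum_powR r01 _ _ dX0 => f; first exact: minor_weight_ge0.
exact: prodr_gt0.
Qed.

End compressions.

Section ky_fan.
Context {R : realType}.
Local Notation C := (Cx R).

Lemma conjdiag_pid N k (kN : (k <= N)%N) (d : 'rV[R]_N) :
  conjdiag (pid_mx k : 'M[C]_(N, k)) d = rdiag (\row_j d 0 (widen_ord kN j)).
Proof.
apply/matrixP => i j.
rewrite conjdiagE (bigD1 (widen_ord kN i))//= big1 => [|l li]; last first.
  by rewrite !mxE (negbTE (_ : (l : nat) != i)) ?conjC0 ?mul0r.
by rewrite addr0 !mxE /= eqxx !ltn_ord conjC1 mul1r andbT mulr_natr.
Qed.

Lemma pid_isometry N k : (k <= N)%N ->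
  (pid_mx k : 'M[C]_(N, k))^t* *m pid_mx k = 1%:M.
Proof.
move=> kN; rewrite -conjdiag_const1 (conjdiag_pid kN) -[RHS]/((1%:Cx)%:M).
by rewrite -rdiag_const; congr rdiag; apply/rowP => j; rewrite !mxE.
Qed.

Lemma unitarymx_isometry N k (U : 'M[C]_N) (V : 'M[C]_(N, k)) :
  U \is unitarymx -> V^t* *m V = 1%:M -> (U *m V)^t* *m (U *m V) = 1%:M.
Proof.
by move=> uU V1; rewrite adjM mulmxA -(mulmxA _ _ U) unitarymx_adj// mulmx1.
Qed.

Lemma top_eigenframe N k (kN : (k <= N)%N) (A : 'M[C]_N) : A \is hermsymmx ->
  exists2 V : 'M[C]_(N, k), V^t* *m V = 1%:M &
    V^t* *m A *m V = rdiag (\row_j eigvals A 0 (widen_ord kN j)).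
Proof.
move=> hA; have [U uU AE] := hermsymmx_spectral hA.
exists (U^t* *m pid_mx k).
  by apply: unitarymx_isometry (pid_isometry kN); rewrite trmxC_unitary.
rewrite [in LHS]AE conj_conjdiag mulmxA (unitarymxP uU) mul1mx.
exact: conjdiag_pid.
Qed.

Lemma isometry_row_le1 N k (W : 'M[C]_(N, k)) l : W^t* *m W = 1%:M ->
  \sum_j sqmod (W l j) <= 1.
Proof.
move=> W1; set w := \sum_j _.
have [P [PP hP wE]] : exists P : 'M[C]_N,
    [/\ P *m P = P, P \is hermsymmx & re (P l l) = w].
  exists (W *m W^t*); split.
  - by rewrite !mulmxA -(mulmxA W) W1 mulmx1.
  - by apply/hermsymmxP; rewrite adjM trmxCK.
  rewrite mxE raddf_sum; apply: eq_bigr => j _.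
  by rewrite /= !mxE mulrC conjM_sqmod re_cplx.
have sumE : re (P l l) = \sum_m sqmod (P m l).
  rewrite -{1}PP mxE raddf_sum; apply: eq_bigr => m _.
  by rewrite /= (hermsymmxE l m hP) conjM_sqmod re_cplx.
have : w ^+ 2 <= w.
  rewrite -{2}wE sumE (bigD1 l)//= /sqmod wE -addrA lerDl addr_ge0 ?sqr_ge0//.
  by apply: sumr_ge0 => m _; rewrite addr_ge0 ?sqr_ge0.
rewrite !leNgt; apply: contra => w1.
by rewrite expr2 ltr_pMr// (lt_trans ltr01).
Qed.

Lemma isometry_sum N k (W : 'M[C]_(N, k)) : W^t* *m W = 1%:M ->
  \sum_l \sum_j sqmod (W l j) = k%:R.
Proof.
move=> W1; rewrite exchange_big /= (eq_bigr (fun=> 1)) => [|j _].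
  by rewrite sumr_const card_ord.
have /matrixP/(_ j j)/(congr1 re) := W1.
rewrite !mxE eqxx raddf_sum /= => sumE; rewrite -[RHS]sumE.
by apply: eq_bigr => l _; rewrite !mxE conjM_sqmod re_cplx.
Qed.

End ky_fan.

Definition kyfan {R : realType} {n} k (A : 'M[Cx R]_n) : R :=
  \sum_(i < n | (i < k)%N) eigvals A 0 i.

Section ky_fan_sums.
Context {R : realType}.
Local Notation C := (Cx R).

Lemma kyfan_ge N k (A : 'M[C]_N) (V : 'M[C]_(N, k)) : A \is hermsymmx ->
  (k <= N)%N -> V^t* *m V = 1%:M ->
  \sum_j rform A (V *m delta_mx j 0) <= kyfan k A.
Proof.
move=> hA kN V1; have [U uU AE] := hermsymmx_spectral hA.
have W1 := unitarymx_isometry uU V1.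
rewrite [leLHS](_ : _ = \sum_l eigvals A 0 l * \sum_j sqmod ((U *m V) l j)).
  apply: sum_weighted_le_top => // [i j|i|].
  - exact: eigvals_nonincreasing.
  - rewrite isometry_row_le1// andbT; apply: sumr_ge0 => j _.
    exact: sqmod_ge0.
  - exact: isometry_sum.
rewrite {1}AE; under eq_bigr do rewrite rform_conjdiag mulmxA -colE.
rewrite exchange_big; apply: eq_bigr => l _; rewrite mulr_sumr.
by apply: eq_bigr => j _; rewrite [col _ _ _ _]mxE.
Qed.

Lemma kyfan_attained N k (A : 'M[C]_N) : A \is hermsymmx -> (k <= N)%N ->
  exists2 V : 'M[C]_(N, k), V^t* *m V = 1%:M &
    \sum_j rform A (V *m delta_mx j 0) = kyfan k A.
Proof.
move=> hA kN; have [V V1 AE] := top_eigenframe kN hA.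
exists V => //; rewrite /kyfan (big_ord_narrow kN); apply: eq_bigr => j _.
by rewrite -rform_conj AE rform_rdiag_delta mxE.
Qed.

Lemma sum_le_kyfan_rdiag N k (d : 'rV[R]_N) : (k <= N)%N ->
  \sum_(i < N | (i < k)%N) d 0 i <= kyfan k (rdiag d).
Proof.
move=> kN; apply: le_trans (kyfan_ge (hermsymmx_rdiag d) kN (pid_isometry kN)).
rewrite (big_ord_narrow kN); apply: ler_sum => j _.
by rewrite -rform_conj -[_ *m _ *m _]/(conjdiag _ d) conjdiag_pid
  rform_rdiag_delta mxE.
Qed.

Lemma fle_kyfan N k (A B : 'M[C]_N) :
  A \is hermsymmx -> B \is hermsymmx -> (k <= N)%N -> A ⪯ B ->
  kyfan k A <= kyfan k B.
Proof.
move=> hA hB kN AB; have [V V1 <-] := kyfan_attained hA kN.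
by apply: le_trans (kyfan_ge hB kN V1); apply: ler_sum.
Qed.

Lemma rdet_isometry_le N k (A : 'M[C]_N) (V : 'M[C]_(N, k)) : posdef A ->
  V^t* *m V = 1%:M ->
  rdet (V^t* *m A *m V) <= \prod_(i < N | (i < k)%N) eigvals A 0 i.
Proof.
move=> pA V1; have [U uU AE] := hermsymmx_spectral (posdef_herm pA).
rewrite {1}AE conj_conjdiag; apply: rdet_conjdiag_le_top.
- by move=> i; exact: eigvals_gt0.
- by move=> i j; exact: eigvals_nonincreasing.
- exact: unitarymx_isometry.
Qed.

Lemma wgeomean_log_majorization N k r (X A : 'M[C]_N) :
  0 <= r <= 1 -> posdef X -> posdef A -> (k <= N)%N ->
  \prod_(i < N | (i < k)%N) eigvals (wgeomean r X A) 0 i <=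
    \prod_(i < N | (i < k)%N) (eigvals X 0 i `^ (1 - r) * eigvals A 0 i `^ r).
Proof.
move=> r01 pX pA kN; have /andP[r0 r1] := r01.
have [V V1 VE] := top_eigenframe kN (posdef_herm (posdef_wgeomean r pX pA)).
have -> : \prod_(i < N | (i < k)%N) eigvals (wgeomean r X A) 0 i =
    rdet (V^t* *m wgeomean r X A *m V).
  rewrite VE rdet_rdiag (big_ord_narrow kN).
  by apply: eq_bigr => j _; rewrite mxE.
apply: (le_trans (rdet_wgeomean_le r01 pX pA V1)).
have eig0 B (pB : posdef B) i : 0 <= eigvals B 0 i := ltW (eigvals_gt0 i pB).
rewrite big_split /= !prod_powR; [|exact: eig0|exact: eig0].
have powR_rdet_le B t : posdef B -> 0 <= t ->
    rdet (V^t* *m B *m V) `^ t <=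
      (\prod_(i < N | (i < k)%N) eigvals B 0 i) `^ t.
  move=> pB t0; apply: ge0_ler_powR t0 _ _ _ _ (rdet_isometry_le pB V1).
    by rewrite nnegrE; exact/ltW/rdet_gt0/(posdef_conj V1).
  by rewrite nnegrE; apply: prodr_ge0 => i _; exact: eig0.
apply: ler_pM; rewrite ?powR_ge0//; last exact: powR_rdet_le.
by apply: powR_rdet_le => //; rewrite subr_ge0.
Qed.

Lemma kyfan_wgeomean_le N k r (X A : 'M[C]_N) :
  0 <= r <= 1 -> posdef X -> posdef A -> (k <= N)%N ->
  kyfan k (wgeomean r X A) <=
    \sum_(i < N | (i < k)%N) eigvals X 0 i `^ (1 - r) * eigvals A 0 i `^ r.
Proof.
move=> r01 pX pA kN; apply: log_majorization_weak => //.
- by move=> i; apply: eigvals_gt0; exact: posdef_wgeomean.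
- by move=> i; rewrite mulr_gt0// powR_gt0// eigvals_gt0.
- by move=> i j; exact: eigvals_nonincreasing.
- by move=> l lN; exact: wgeomean_log_majorization.
Qed.

End ky_fan_sums.

(** * Topology of positive definite matrices *)

Section second_countability.

Lemma countable_enumeration (T : Type) (x0 : T) (B : set T) : countable B ->
  exists2 e : nat -> T, forall x, B x -> exists n, e n = x &
    forall n, B (e n) \/ e n = x0.
Proof.
move=> /pfcard_geP[->|[f]]; first by exists (fun=> x0) => // n; right.
exists (fun n => if pselect (B (f n)) then f n else x0) => [x Bx|n].
  have [n _ fn] := 'surj_f Bx; exists n.
  by case: pselect => //; rewrite fn.
by case: pselect => Bfn; [left|right].
Qed.

Lemma second_countable_initial (S : choiceType) (T : topologicalType)
    (f : S -> T) :
  @second_countable T -> @second_countable (initial_topology f).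
Proof.
move=> [B B_countable [B_open B_basis]].
exists [set f @^-1` U | U in B]; last split.
- exact: sub_countable (card_image_le _ _) B_countable.
- by move=> _ [U BU <-]; exists U => //; exact: B_open.
- move=> x A [_ [[W W_open <-] Wfx WA]].
  have [U [BU Ufx] UW] := B_basis (f x) W (open_nbhs_nbhs (conj W_open Wfx)).
  by exists (f @^-1` U); [split=> //; exists U|move=> y /UW /WA].
Qed.

Lemma second_countable_mx (T : topologicalType) m n :
  @second_countable T -> @second_countable 'M[T]_(m, n).
Proof.
move=> [B /(countable_enumeration set0)[e eB Be] [B_open B_basis]].
have e_open k : open (e k).
  by have [/B_open //|->] := Be k; exact: open0.
pose box (q : {ffun 'I_m * 'I_n -> nat}) : set 'M[T]_(m, n) :=
  [set M | forall i j, e (q (i, j)) (M i j)].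
exists (range box); last split.
- exact: sub_countable (card_image_le _ _) (countableP _).
- move=> _ [q _ <-]; rewrite openE => M qM.
  exists (fun i j => e (q (i, j))) => // i j.
  by apply: open_nbhs_nbhs; split.
- move=> M A [P P_nbhs PA].
  have /choice[q qP] : forall ij : 'I_m * 'I_n, exists k,
      e k (M ij.1 ij.2) /\ e k `<=` P ij.1 ij.2.
    move=> ij; have [U [/eB[k <-] UM] UP] := B_basis _ _ (P_nbhs ij.1 ij.2).
    by exists k.
  exists (box (finfun q)).
    by split=> [|i j]; [exists (finfun q)|rewrite ffunE; have [] := qP (i, j)].
  move=> M' box_M'; apply: PA => i j; have [_] := qP (i, j); apply.
  by have := box_M' i j; rewrite ffunE.
Qed.

Lemma rational_approximation {R : realType} (z : Cx R) (e : R) : 0 < e ->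
  exists q : rat * rat,
    ball z e%:Cx (Complex (ratr q.1) (ratr q.2) : Cx R).
Proof.
move=> e0.
have approx (x : R) : exists q : rat, `|x - ratr q| < e / 2.
  have [|q] := @rat_in_itvoo R (x - e / 2) (x + e / 2).
    by rewrite ltrD2l gtrN ?divr_gt0.
  by rewrite in_itv /= => xq; exists q; rewrite ltr_distlC.
have [[p zp] [q zq]] := (approx (re z), approx (im z)).
exists (p, q); apply: (le_lt_trans (ler_normC_re_im _)).
by rewrite !raddfB ltr_cplx [ltRHS]splitr ltrD.
Qed.

Lemma second_countable_Cx {R : realType} : @second_countable (Cx R).
Proof.
pose rball (c : rat * rat * nat) : set (Cx R) :=
  ball (Complex (ratr c.1.1) (ratr c.1.2) : Cx R) (c.2.+1%:R^-1)%:Cx.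
exists (range rball); last split.
- exact: sub_countable (card_image_le _ _) (countableP _).
- by move=> _ [c _ <-]; exact: ball_open.
- move=> z A /nbhs_ballP[e /= e0 eA].
  have re_e0 : 0 < re e by rewrite -cplx_gt0 -gt0_cplx_re.
  have [n] := ltr_add_invr (divr_gt0 re_e0 (ltr0n R 2)); rewrite add0r => n_e.
  have n0 : 0 < n.+1%:R^-1 :> R by rewrite invr_gt0.
  have [q zq] := rational_approximation z n0.
  exists (rball (q, n)); first by split; [exists (q, n)|exact/ball_sym].
  move=> w qw; apply: eA; rewrite (gt0_cplx_re e0).
  apply: (le_ball _ (ball_triangle zq qw)).
  by rewrite -rmorphD ler_cplx [leRHS]splitr lerD ?ltW.
Qed.

End second_countability.

Section borel_measurability.

Lemma ae_msupport (R : realType) (T : ptopologicalType)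
    (mu : {measure set (borel T) -> \bar R}) :
  @second_countable T -> {ae mu, forall x, msupport mu x}.
Proof.
move=> [B B_countable [B_open B_basis]].
pose null : set (set (borel T)) := [set U | B U /\ mu U = 0%E].
have /(countable_enumeration set0)[e nulle enull] : countable null.
  by apply: sub_countable B_countable; apply: subset_card_le => U [].
have open_measurable (U : set T) : open U -> measurable (U : set (borel T)).
  exact: sub_sigma_algebra.
apply: (@negligibleS _ _ _ _ (\bigcup_k e k)); last first.
  apply: negligible_bigcup => k; have [[/B_open e_open e0]|->] := enull k.
    by apply/negligibleP => //; exact: open_measurable.
  exact: negligible_set0.
move=> x /= /existsNP[G /not_implyP[G_open /not_implyP[Gx /negP]]].
rewrite -leNgt => muG.
have [U [BU Ux] UG] := B_basis x G (open_nbhs_nbhs (conj G_open Gx)).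
have [k ekU] : exists k, e k = U.
  apply: nulle; split=> //; apply/eqP; rewrite eq_le measure_ge0 andbT.
  apply: le_trans muG; apply: le_measure => //; rewrite inE.
    by apply: open_measurable; exact: B_open.
  exact: open_measurable.
by exists k => //; rewrite ekU.
Qed.

Lemma continuous_borel_measurable (T U : ptopologicalType) (f : T -> U) :
  continuous f ->
  measurable_fun [set: borel T] (f : borel T -> borel U).
Proof.
move=> /continuousP f_cont.
apply: (@measurability _ _ (borel T) (borel U) _ _ (@open U) erefl).
by move=> _ [G oG <-]; rewrite setTI; apply: sub_sigma_algebra; exact: f_cont.
Qed.

Lemma continuous_borel_measurable_realfun (R : realType)
    (T : ptopologicalType) (f : T -> R) :
  continuous f -> measurable_fun [set: borel T] f.
Proof.
move=> /continuousP f_cont.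
apply: (measurability _ (measurable_realfun.RGenOpens.measurableE R)).
move=> _ [_ [a [b ->] <-]]; rewrite setTI; apply: sub_sigma_algebra.
exact/f_cont/interval_open.
Qed.

End borel_measurability.

Section matrix_topology.
Context {R : realType}.
Local Notation C := (Cx R).

Lemma cvg_mx (T : topologicalType) (I : Type) (F : set_system I) m n
    (f : I -> 'M[T]_(m, n)) (L : 'M[T]_(m, n)) : Filter F ->
  (forall i j, f x i j @[x --> F] --> L i j) -> f x @[x --> F] --> L.
Proof.
move=> FF fL A [P P_nbhs PA].
have : \forall x \near F, forall i j, P i j (f x i j).
  by apply: filter_forall => i; apply: filter_forall => j; exact/fL/P_nbhs.
by apply: filterS => x Pfx; exact: PA.
Qed.

Lemma cvg_Cx (I : Type) (F : set_system I) (f : I -> C) (l : C) : Filter F ->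
  re (f x) @[x --> F] --> re l -> im (f x) @[x --> F] --> im l ->
  f x @[x --> F] --> l.
Proof.
move=> FF /cvgrPdist_lt fre /cvgrPdist_lt fim; apply/cvgrPdist_lt => e e0.
have re_e2 : 0 < re e / 2 by rewrite divr_gt0// -cplx_gt0 -gt0_cplx_re.
near=> x; apply: (le_lt_trans (ler_normC_re_im _)).
rewrite (gt0_cplx_re e0) ltr_cplx [ltRHS]splitr !raddfB /=.
by apply: ltrD; near: x; [exact: fre|exact: fim].
Unshelve. all: by end_near. Qed.

Lemma cvg_cplx (I : Type) (F : set_system I) (f : I -> R) (l : R) : Filter F ->
  f x @[x --> F] --> l -> (f x)%:Cx @[x --> F] --> l%:Cx.
Proof. by move=> FF fl; apply: cvg_Cx => //; exact: cvg_cst. Qed.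

Lemma rform_bound n (A : 'M[C]_n) v (e : R) : (forall i j, `|A i j| <= e%:Cx) ->
  `|rform A v| <= n%:R * e * sqnorm v.
Proof.
move=> Ae; rewrite -ler_cplx; apply: (le_trans (ge_norm_re _)).
have term_le i j : `|(v i 0)^* * A i j * v j 0| <=
    (e / 2 * (sqmod (v i 0) + sqmod (v j 0)))%:Cx.
  rewrite !normrM norm_conjC mulrAC [_ * `|A i j|]mulrC.
  have mean_le : `|v i 0| * `|v j 0| <=
      (2^-1 * (sqmod (v i 0) + sqmod (v j 0)))%:Cx.
    rewrite rmorphM rmorphD /= -!normC_sqmod fmorphV rmorph_nat [leRHS]mulrC.
    exact: (real_leif_mean_square (normr_real _) (normr_real _)).1.
  apply: (le_trans (ler_pM _ _ (Ae i j) mean_le)); rewrite ?mulr_ge0//.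
  by rewrite -rmorphM mulrA.
have -> : qform A v = \sum_i \sum_j (v i 0)^* * A i j * v j 0.
  rewrite /qform mxE exchange_big; apply: eq_bigr => j _ /=.
  by rewrite mxE mulr_suml; apply: eq_bigr => i _; rewrite !mxE.
apply: (le_trans (ler_norm_sum _ _ _)).
apply: le_trans (_ : _ <= \sum_i \sum_j _) _.
  apply: ler_sum => i _; apply: (le_trans (ler_norm_sum _ _ _)).
  by apply: ler_sum => j _; exact: term_le.
under eq_bigr => i _.
  rewrite -rmorph_sum -mulr_sumr big_split /= sumr_const card_ord.
  over.
rewrite -rmorph_sum -mulr_sumr big_split /= sumrMnl sumr_const card_ord.
rewrite ler_cplx -/(sqnorm v) -[sqnorm v *+ n]mulr_natr.
by rewrite le_eqVlt; apply/orP; left; apply/eqP; field.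
Qed.

Lemma posdef_bounds n (A : 'M[C]_n) : posdef A ->
  exists a b : R, [/\ 0 < a, 0 < b & scalar_between a b A].
Proof.
move=> /posdef_spectral[U [d [uU -> d0]]].
pose a := \big[Order.min/1]_i d 0 i; pose b := \big[Order.max/1]_i d 0 i.
exists a, b; split.
- exact: lt_bigmin.
- exact: lt_le_trans ltr01 (bigmax_ge_id _ _ _ _).
- by apply: (scalar_between_conjdiag uU) => i; rewrite bigmin_le le_bigmax.
Qed.

Lemma near_rform n (A : 'M[C]_n) (t : R) : posdef A -> 0 < t ->
  \forall B \near A, forall v, `|rform (B - A) v| <= t * rform A v.
Proof.
move=> pA t0; have [a [_ [a0 _ [aA _]]]] := posdef_bounds pA.
have n0 : 0 < n%:R + 1 :> R by rewrite ltr_wpDl.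
have e0 : 0 < t * a / (n%:R + 1) by rewrite divr_gt0// mulr_gt0.
apply/nbhs_ballP; exists (t * a / (n%:R + 1))%:Cx; first by rewrite /= cplx_gt0.
move=> B [_ AB] v.
apply: le_trans (rform_bound v (e := t * a / (n%:R + 1)) _) _.
  by move=> i j; rewrite !mxE distrC ltW//; exact: AB.
apply: le_trans (_ : _ <= t * (a * sqnorm v)) _.
  rewrite [leRHS]mulrA ler_wpM2r ?sqnorm_ge0// mulrA ler_pdivrMr// mulrC.
  by rewrite ler_wpM2l ?mulr_ge0 ?lerDl ?ltW.
by rewrite ler_pM2l// -rform_scalar; exact: aA.
Qed.

Lemma near_fle n (A : 'M[C]_n) (t : R) : posdef A -> 0 < t ->
  \forall B \near A, (1 - t)%:Cx *: A ⪯ B /\ B ⪯ (1 + t)%:Cx *: A.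
Proof.
move=> pA t0; apply: filterS (near_rform pA t0) => B AB.
split=> v; have := AB v; rewrite rformB rformZ ler_norml => /andP[].
  by move: (rform B v) (rform A v) => b a; lra.
by move: (rform B v) (rform A v) => b a; lra.
Qed.

Lemma continuous_rform n v : continuous (fun A : 'M[C]_n => rform A v).
Proof.
move=> A; apply/(@cvgrPdist_le _ _ _ (nbhs A) (nbhs_filter A)) => e e0.
have c0 : 0 < n%:R * sqnorm v + 1 by rewrite ltr_wpDl// mulr_ge0 ?sqnorm_ge0.
apply/nbhs_ballP; exists (e / (n%:R * sqnorm v + 1))%:Cx => /=.
  by rewrite cplx_gt0 divr_gt0.
move=> B [_ AB]; rewrite -rformB.
apply: le_trans (rform_bound v (e := e / (n%:R * sqnorm v + 1)) _) _.
  by move=> i j; rewrite !mxE ltW//; exact: AB.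
rewrite mulrAC mulrA ler_pdivrMr// mulrC ler_wpM2l ?(ltW e0)//.
by rewrite lerDl.
Qed.

Lemma cvg_rform n (I : Type) (F : set_system I) (X : I -> 'M[C]_n) L v :
  X k @[k --> F] --> L -> rform (X k) v @[k --> F] --> rform L v.
Proof. by move=> XL; exact: (cvg_comp _ _ XL (@continuous_rform n v L)). Qed.

End matrix_topology.

Section positive_definite_space.
Context {R : realType} {N : nat}.
Local Notation C := (Cx R).
Implicit Types A B : PD R N.

Lemma second_countable_PD : @second_countable (PD R N).
Proof.
exact/second_countable_initial/second_countable_mx/second_countable_Cx.
Qed.

Lemma continuous_PD_val : continuous (fun A : PD R N => A : 'M[C]_N).
Proof. exact: initial_continuous. Qed.

Lemma continuous_PDP (T : topologicalType) (f : T -> PD R N) :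
  (forall i j, continuous (fun x => (f x : 'M[C]_N) i j)) -> continuous f.
Proof.
move=> f_cont; apply: continuous_comp_initial => x.
by apply: cvg_mx => i j; exact: f_cont.
Qed.

(* Such functions are exponentials of functions that are 1-Lipschitz for the
   Thompson metric of the cone of positive definite matrices. *)
Definition thompson_lipschitz (g : PD R N -> R) : Prop :=
  forall (c : R) A B, 1 <= c -> A ⪯ c%:Cx *: (B : 'M[C]_N) -> g A <= c * g B.

Lemma thompson_lipschitz_continuous g : (forall A, 0 <= g A) ->
  thompson_lipschitz g -> continuous g.
Proof.
move=> g0 g_lip.
suff near_g A (e : R) : 0 < e -> \forall B \near A, `|g A - g B| <= e.
  move=> A; apply/(@cvgrPdist_le _ _ _ (nbhs A) (nbhs_filter A)) => e.
  exact: near_g.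
move=> e0.
pose t := Order.min 2^-1 (e / (g A + 1) / 2).
have gA1 : 0 < g A + 1 by rewrite ltr_wpDl.
have t0 : 0 < t by rewrite lt_min !divr_gt0// invr_gt0 ltr0n.
have t_half : t <= 2^-1 by rewrite ge_min lexx.
have t_e : t * (g A + 1) <= e / 2.
  by rewrite -ler_pdivlMr// mulrAC ge_min lexx orbT.
have near_A : nbhs A [set B : PD R N | (1 - t)%:Cx *: (A : 'M[C]_N) ⪯ B /\
    B ⪯ (1 + t)%:Cx *: (A : 'M[C]_N)].
  exact: (@continuous_PD_val A _ (near_fle (PD_posdef A) t0)).
apply: (@filterS _ (nbhs A) _ _ _ _ near_A) => B [AB BA].
have gB_le : g B <= (1 + t) * g A by apply: g_lip BA; lra.
have gA_le : (1 - t) * g A <= g B.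
  have : g A <= (1 - t)^-1 * g B.
    apply: g_lip => [|v]; first by rewrite invf_ge1; lra.
    by rewrite rformZ ler_pdivlMl; [rewrite -rformZ; exact: AB|lra].
  by rewrite ler_pdivlMl//; lra.
by rewrite ler_norml; apply/andP; split; lra.
Qed.

Lemma kyfan_thompson_lipschitz k : (k <= N)%N ->
  thompson_lipschitz (fun A => kyfan k A).
Proof.
move=> kN c A B c1 AB.
have [V V1 <-] := kyfan_attained (posdef_herm (PD_posdef A)) kN.
apply: le_trans (_ : _ <= c * \sum_j rform B (V *m delta_mx j 0)) _.
  by rewrite mulr_sumr; apply: ler_sum => j _; rewrite -rformZ; exact: AB.
apply: ler_wpM2l; first by lra.
exact: kyfan_ge (posdef_herm (PD_posdef B)) kN V1.
Qed.

Lemma continuous_eigvals i : continuous (fun A : PD R N => eigvals A 0 i).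
Proof.
have -> : (fun A : PD R N => eigvals A 0 i) =
    (fun A : PD R N => kyfan i.+1 A - kyfan i A).
  apply/funext => A; rewrite /kyfan (big_ord_ltS _ (ltn_ord i)) /= addrAC subrr.
  by rewrite add0r; congr (eigvals _ _ _); exact: val_inj.
have kyfan_cont k : (k <= N)%N -> continuous (fun A : PD R N => kyfan k A).
  move=> kN; apply: thompson_lipschitz_continuous (kyfan_thompson_lipschitz kN).
  by move=> A; apply: sumr_ge0 => j _; exact/ltW/eigvals_gt0/PD_posdef.
move=> A; have iN := ltn_ord i.
exact: (cvgB (kyfan_cont _ iN A) (kyfan_cont _ (ltnW iN) A)).
Qed.

Lemma continuous_eigdiag : continuous (@eigdiag R N).
Proof.
apply: continuous_PDP => i j.
have -> : (fun A : PD R N => (eigdiag A : 'M[C]_N) i j) =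
    (fun A : PD R N => (eigvals A 0 i * (i == j)%:R)%:Cx).
  by apply/funext => A; rewrite !mxE mulr_natr rmorphMn.
move=> A; apply: (@cvg_cplx _ _ (nbhs A) _ _ (nbhs_filter A)).
exact: (cvgMr_tmp (@continuous_eigvals i A)).
Qed.

End positive_definite_space.

(** * Integration of Hermitian matrices *)

Definition real_integrable d (T : measurableType d) (R : realType)
    (mu : {measure set T -> \bar R}) (f : T -> R) : Prop :=
  mu.-integrable [set: T] (EFin \o f).

Section real_integrals.
Context d (T : measurableType d) (R : realType).
Variable mu : {measure set T -> \bar R}.
Implicit Types f g : T -> R.

Lemma real_integrableD f g : real_integrable mu f -> real_integrable mu g ->
  real_integrable mu (fun x => f x + g x).
Proof. exact: (integrableD measurableT). Qed.

Lemma real_integrableB f g : real_integrable mu f -> real_integrable mu g ->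
  real_integrable mu (fun x => f x - g x).
Proof. exact: (integrableB measurableT). Qed.

Lemma real_integrableZl c f : real_integrable mu f ->
  real_integrable mu (fun x => c * f x).
Proof. exact: (integrableZl measurableT). Qed.

Lemma real_integrable_sum (I : Type) (s : seq I) (P : pred I)
    (f : I -> T -> R) :
  (forall i, real_integrable mu (f i)) ->
  real_integrable mu (fun x => \sum_(i <- s | P i) f i x).
Proof.
move=> f_int.
have -> : real_integrable mu (fun x => \sum_(i <- s | P i) f i x) =
    mu.-integrable [set: T] (fun x => \sum_(i <- s | P i) (f i x)%:E)%E.
  by congr integrable; apply/funext => x; rewrite /= sumEFin.
by apply: integrable_sum => // i _; exact: f_int.
Qed.

Lemma Rintegral_sum (I : Type) (s : seq I) (P : pred I) (f : I -> T -> R) :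
  (forall i, real_integrable mu (f i)) ->
  \int[mu]_x (\sum_(i <- s | P i) f i x) =
    \sum_(i <- s | P i) \int[mu]_x f i x.
Proof.
move=> f_int; rewrite /Rintegral sum_fine => [|i _]; last first.
  exact: integrable_fin_num (f_int i).
rewrite -(integral_sum measurableT (f := fun i x => (f i x)%:E))//.
by congr fine; apply: eq_integral => x _; rewrite sumEFin.
Qed.

Lemma ae_le_Rintegral f g : real_integrable mu f -> real_integrable mu g ->
  {ae mu, forall x, f x <= g x} -> \int[mu]_x f x <= \int[mu]_x g x.
Proof.
move=> f_int g_int fg; have gf_int := real_integrableB g_int f_int.
rewrite -subr_ge0 -RintegralB//.
have -> : \int[mu]_x (g x - f x) = \int[mu]_x `|g x - f x|.
  congr fine; apply: ae_eq_integral => //.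
  - exact: measurable_int gf_int.
  - exact: measurable_int (integrable_norm gf_int).
  - by apply: filterS fg => x fgx _; rewrite ger0_norm ?subr_ge0.
exact: Rintegral_ge0.
Qed.

End real_integrals.

Lemma real_integrable_ae_bounded d (T : measurableType d) (R : realType)
    (mu : {finite_measure set T -> \bar R}) (f : T -> R) (M : R) :
  measurable_fun [set: T] f -> {ae mu, forall x, `|f x| <= M} ->
  real_integrable mu f.
Proof.
move=> mf fM; apply/integrableP.
split; first exact/measurable_realfun.measurable_EFinP.
apply: le_lt_trans (_ : _ <= `|M|%:E * mu [set: T])%E _.
  apply: integral_le_bound => //.
    exact/measurable_realfun.measurable_EFinP.
  apply: filterS fM => x fxM _; rewrite lee_fin.
  exact: le_trans fxM (ler_norm M).
by rewrite lte_mul_pinfty// fin_num_fun_lty//; exact: fin_num_measure.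
Qed.

Lemma Rintegral_probability_cst d (T : measurableType d) (R : realType)
    (P : probability T R) (c : R) : \int[P]_x c = c.
Proof. by rewrite Rintegral_cst//= probability_setT mulr1. Qed.

Lemma Rintegral_distribution d d' (T : measurableType d) (U : measurableType d')
    (R : realType) (P : probability T R) (f : {mfun T >-> U}) (g : U -> R) :
  measurable_fun [set: U] g -> real_integrable P (g \o f) ->
  \int[distribution P f]_y g y = \int[P]_x g (f x).
Proof.
move=> mg gf_int; congr fine; apply: integral_distribution => //.
exact/measurable_realfun.measurable_EFinP.
Qed.

Section matrix_integrals.
Context {R : realType} {N : nat}.
Local Notation C := (Cx R).
Local Notation BPD := (borel (PD R N)).
Variable mu : {measure set BPD -> \bar R}.
Variable F : PD R N -> 'M[C]_N.
Hypothesis F_herm : forall A, F A \is hermsymmx.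
Hypothesis F_int : forall v, real_integrable mu (fun A : BPD => rform (F A) v).

Lemma real_integrable_re_entry i j :
  real_integrable mu (fun A : BPD => re (F A i j)).
Proof.
rewrite (_ : (fun A : BPD => _) = (fun A : BPD => 2^-1 *
    (rform (F A) (delta_mx i 0 + delta_mx j 0) -
     rform (F A) (delta_mx i 0) - rform (F A) (delta_mx j 0)))).
  by apply: real_integrableZl; do 2 apply: real_integrableB => //.
by apply/funext => A; rewrite (re_polarization _ _ (F_herm A)) mulrC.
Qed.

Lemma real_integrable_im_entry i j :
  real_integrable mu (fun A : BPD => im (F A i j)).
Proof.
rewrite (_ : (fun A : BPD => _) = (fun A : BPD => 2^-1 *
    (rform (F A) (delta_mx i 0) + rform (F A) (delta_mx j 0) -
     rform (F A) (delta_mx i 0 + 'i *: delta_mx j 0)))).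
  apply: real_integrableZl; apply: real_integrableB => //.
  exact: real_integrableD.
by apply/funext => A; rewrite (im_polarization _ _ (F_herm A)) mulrC.
Qed.

Lemma re_mxintegral i j : re (mxintegral mu F i j) = \int[mu]_A re (F A i j).
Proof. by rewrite mxE. Qed.

Lemma im_mxintegral i j : im (mxintegral mu F i j) = \int[mu]_A im (F A i j).
Proof. by rewrite mxE. Qed.

Lemma hermsymmx_mxintegral : mxintegral mu F \is hermsymmx.
Proof.
apply/hermsymmxP/matrixP => i j; rewrite [LHS]mxE [X in X^*]mxE.
apply: eq_re_im; rewrite ?re_conj ?im_conj.
  rewrite !re_mxintegral; congr fine; apply: eq_integral => A _.
  by rewrite (hermsymmxE j i (F_herm A)) re_conj.
rewrite !im_mxintegral -mulN1r -RintegralZl//; last first.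
  exact: real_integrable_im_entry.
congr fine; apply: eq_integral => A _.
by rewrite (hermsymmxE j i (F_herm A)) im_conj mulrN mulN1r opprK.
Qed.

Lemma rform_mxintegral v :
  rform (mxintegral mu F) v = \int[mu]_A rform (F A) v.
Proof.
have term_int i j : real_integrable mu (fun A : BPD =>
    re ((v i 0)^* * v j 0) * re (F A i j) -
    im ((v i 0)^* * v j 0) * im (F A i j)).
  apply: real_integrableB; apply: real_integrableZl.
    exact: real_integrable_re_entry.
  exact: real_integrable_im_entry.
under [RHS]eq_Rintegral do rewrite rformE.
rewrite Rintegral_sum => [|i]; last exact: real_integrable_sum.
rewrite rformE; apply: eq_bigr => i _; rewrite Rintegral_sum//.
apply: eq_bigr => j _; rewrite re_mxintegral im_mxintegral.
have re_int := real_integrable_re_entry i j.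
have im_int := real_integrable_im_entry i j.
rewrite RintegralB//; [|exact: real_integrableZl|exact: real_integrableZl].
by rewrite !RintegralZl.
Qed.

End matrix_integrals.

(** * Order-preserving homogeneous maps *)

Section monotone_convergence.
Context {R : realType}.
Local Notation C := (Cx R).

Lemma nondecreasing_hermsymmx_cvg n (X : nat -> 'M[C]_n) (B : 'M[C]_n) :
  (forall k, X k \is hermsymmx) -> (forall k, X k ⪯ X k.+1) ->
  (forall k, X k ⪯ B) ->
  exists2 L, L \is hermsymmx & X k @[k --> \oo] --> L.
Proof.
move=> X_herm X_nd XB.
have form_cvg v : cvgn (fun k => rform (X k) v).
  apply: nondecreasing_is_cvgn.
    apply: homo_leq => [x|x y z|k]; [exact: lexx|exact: le_trans|exact: X_nd].
  by exists (rform B v) => _ [k _ <-]; exact: XB.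
have re_cvg i j : cvgn (fun k => re (X k i j)).
  under eq_fun do rewrite (re_polarization _ _ (X_herm _)).
  by apply: is_cvgMl; apply: is_cvgB => //; apply: is_cvgB.
have im_cvg i j : cvgn (fun k => im (X k i j)).
  under eq_fun do rewrite (im_polarization _ _ (X_herm _)).
  by apply: is_cvgMl; apply: is_cvgB => //; apply: is_cvgD.
exists (\matrix_(i, j) (Complex (limn (fun k => re (X k i j)))
    (limn (fun k => im (X k i j))) : C)).
  apply/hermsymmxP/matrixP => i j; rewrite !mxE; apply: eq_re_im.
    rewrite re_conj; congr (limn _); apply/funext => k.
    by rewrite (hermsymmxE i j (X_herm k)) re_conj.
  rewrite im_conj -limN//; congr (limn _); apply/funext => k.
  by rewrite (hermsymmxE i j (X_herm k)) im_conj.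
apply: cvg_mx => i j; rewrite mxE.
by apply: cvg_Cx; [exact: re_cvg|exact: im_cvg].
Qed.

Lemma nondecreasing_fle_lim n (X : nat -> 'M[C]_n) L :
  (forall k, X k ⪯ X k.+1) -> X k @[k --> \oo] --> L -> forall k, X k ⪯ L.
Proof.
move=> X_nd XL k v; have form_cvg := cvg_rform (v := v) XL.
rewrite -(cvg_lim _ form_cvg)//.
apply: nondecreasing_cvgn_le (cvgP _ form_cvg) k.
by apply: homo_leq => [x|x y z|l]; [exact: lexx|exact: le_trans|exact: X_nd].
Qed.

Lemma fle_lim n (X : nat -> 'M[C]_n) L B :
  (forall k, X k ⪯ B) -> X k @[k --> \oo] --> L -> L ⪯ B.
Proof.
move=> XB XL v; apply: ler_cvg_to (cvg_rform (v := v) XL) (cvg_cst _) _.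
by near=> k; exact: XB.
Unshelve. all: by end_near. Qed.

End monotone_convergence.

Section fixed_points.
Context {R : realType} {n : nat}.
Local Notation C := (Cx R).
Variables (p : R) (F : 'M[C]_n -> 'M[C]_n).
Hypothesis p_itv : 0 <= p < 1.
Hypothesis F_posdef : forall X, posdef X -> posdef (F X).
Hypothesis F_homo : forall X Y, posdef X -> posdef Y -> X ⪯ Y -> F X ⪯ F Y.
Hypothesis F_homogeneous : forall (c : R) X, 0 < c -> posdef X ->
  F (c%:Cx *: X) = (c `^ p)%:Cx *: F X.

(* If [c D <= Y] then [c^p D <= F (c D) <= F Y <= Y], and the iterates of
   [c |-> c^p] tend to 1. *)
Lemma fle_sub_super_fixpoint (D Y : 'M[C]_n) : posdef D -> posdef Y ->
  D ⪯ F D -> F Y ⪯ Y -> D ⪯ Y.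
Proof.
move=> pD pY DF FY; have [c c0 cDY] : exists2 c : R, 0 < c & c%:Cx *: D ⪯ Y.
  have [_ [b [_ b0 [_ Db]]]] := posdef_bounds pD.
  have [a [_ [a0 _ [aY _]]]] := posdef_bounds pY.
  exists (a / b); first exact: divr_gt0.
  move=> v; apply: le_trans (aY v); rewrite rformZ rform_scalar.
  rewrite mulrAC ler_pdivrMr// -mulrA ler_pM2l// mulrC -rform_scalar.
  exact: Db.
have iter_fle k : (c `^ (p ^+ k))%:Cx *: D ⪯ Y.
  elim: k => [|k IHk]; first by rewrite expr0 powRr1// ltW.
  have ck0 : 0 < c `^ (p ^+ k) by rewrite powR_gt0.
  apply: fle_trans FY; apply: fle_trans (F_homo (posdefZ ck0 pD) pY IHk).
  rewrite (F_homogeneous ck0 pD) -powRrM -exprSr => v; rewrite !rformZ.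
  by rewrite ler_wpM2l ?powR_ge0//; exact: DF.
have pow_cvg : c `^ (p ^+ k) @[k --> \oo] --> (1 : R).
  rewrite -[X in _ --> X](powRr0 c) /powR gt_eqF//.
  apply: (@continuous_cvg _ _ _ _ _ (fun k => p ^+ k * ln c) expR).
    exact: continuous_expR.
  apply: cvgMr_tmp; apply: cvg_expr.
  by have /andP[p0 p1] := p_itv; rewrite ger0_norm.
move=> v; rewrite -[leLHS]mul1r.
apply: ler_cvg_to (cvgMr_tmp pow_cvg) (cvg_cst _) _.
by near=> k; rewrite -rformZ; exact: iter_fle.
Unshelve. all: by end_near. Qed.

(* [F L] is the limit from below of [F (c L) = c^p F L] as [c] tends to 1, and
   [c L <= X k] for some [k]. *)
Lemma fle_map_lim (X : nat -> 'M[C]_n) (L B : 'M[C]_n) :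
  (forall k, posdef (X k)) -> posdef L -> X k @[k --> \oo] --> L ->
  (forall k, F (X k) ⪯ B) -> F L ⪯ B.
Proof.
move=> pX pL XL FXB v; apply: ler_mul_lt1 => c /andP[c0 c1].
have [k cLX] : exists k, c%:Cx *: L ⪯ X k.
  have c1' : 0 < 1 - c by rewrite subr_gt0.
  have near_L : \forall k \near \oo, (1 - (1 - c))%:Cx *: L ⪯ X k /\
      X k ⪯ (1 + (1 - c))%:Cx *: L.
    exact: XL (near_fle pL c1').
  have [k [cLX _]] := filter_ex near_L; exists k.
  by rewrite -[c](subKr 1).
apply: le_trans (FXB k v).
apply: le_trans (F_homo (posdefZ c0 pL) (pX k) cLX v).
rewrite (F_homogeneous c0 pL) rformZ ler_wpM2r//.
  exact/posdef_rform_ge0/F_posdef.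
by apply: ger1_powR; [rewrite c0 ltW|have /andP[_ /ltW] := p_itv].
Qed.

Lemma fixpoint_exists (A B : 'M[C]_n) : posdef A -> posdef B ->
  A ⪯ F A -> F B ⪯ B -> exists2 X, posdef X & F X = X.
Proof.
move=> pA pB AF FB.
have [X X0 XS] : exists2 X : nat -> 'M[C]_n,
    X 0 = A & forall k, X k.+1 = F (X k).
  by exists (fun k => iter k F A).
have pX k : posdef (X k).
  by elim: k => [|k IHk]; [rewrite X0|rewrite XS; exact: F_posdef].
have X_nd k : X k ⪯ X k.+1.
  elim: k => [|k IHk]; first by rewrite XS X0.
  by rewrite [X in X ⪯ _]XS [X in _ ⪯ X]XS; exact: F_homo (pX k) (pX k.+1) IHk.
have AB : A ⪯ B by exact: fle_sub_super_fixpoint.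
have XB k : X k ⪯ B.
  elim: k => [|k IHk]; first by rewrite X0.
  by rewrite XS; apply: fle_trans FB; exact: F_homo (pX k) pB IHk.
have hX k := posdef_herm (pX k).
have [L hL XL] := nondecreasing_hermsymmx_cvg hX X_nd XB.
have X_le_L := nondecreasing_fle_lim X_nd XL.
have pL : posdef L := posdef_fle (pX 0) hL (X_le_L 0).
exists L; first exact: pL.
have hFL := posdef_herm (F_posdef pL); apply: (fle_anti hFL hL).
  by apply: fle_map_lim pX pL XL _ => k; rewrite -XS; exact: X_le_L.
apply: fle_lim XL => k; apply: fle_trans (X_nd k) _; rewrite XS.
exact: F_homo (pX k) pL (X_le_L k).
Qed.

End fixed_points.

(** * The power map *)

Section power_map.
Context {R : realType} {N : nat}.
Local Notation C := (Cx R).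
Local Notation BPD := (borel (PD R N)).

Definition powmap (mu : set BPD -> \bar R) (r : R) (X : 'M[C]_N) : 'M[C]_N :=
  mxintegral mu (fun A => wgeomean r X A).

Definition ae_between (mu : {measure set BPD -> \bar R}) (a b : R) : Prop :=
  {ae mu, forall A : BPD, scalar_between a b (mx_of_PD A)}.

Lemma rform_wgeomean_ge0 r (X : 'M[C]_N) v (A : PD R N) :
  posdef X -> 0 <= rform (wgeomean r X A) v.
Proof.
by move=> pX; exact: posdef_rform_ge0 (posdef_wgeomean r pX (PD_posdef A)).
Qed.

Lemma rform_wgeomean_thompson_lipschitz r (X : 'M[C]_N) v :
  0 <= r <= 1 -> posdef X ->
  thompson_lipschitz (fun A => rform (wgeomean r X A) v).
Proof.
move=> r01 pX c A B c1 AB; have c0 : 0 < c := lt_le_trans ltr01 c1.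
have pB := PD_posdef B; have /andP[_ r1] := r01.
apply: le_trans (fle_wgeomeanr r01 pX (PD_posdef A) (posdefZ c0 pB) AB v) _.
rewrite (wgeomeanZr _ c0 pX pB) rformZ ler_wpM2r ?rform_wgeomean_ge0//.
exact: ler1_powR.
Qed.

Lemma measurable_rform_wgeomean r (X : 'M[C]_N) v : 0 <= r <= 1 -> posdef X ->
  measurable_fun [set: BPD]
    (fun A : BPD => rform (wgeomean r X (mx_of_PD A)) v).
Proof.
move=> r01 pX; apply: continuous_borel_measurable_realfun.
have form_lip := rform_wgeomean_thompson_lipschitz v r01 pX.
apply: thompson_lipschitz_continuous form_lip => A.
exact: rform_wgeomean_ge0.
Qed.

Section fixed_measure.
Variables (mu : probability BPD R) (r a b : R).
Hypotheses (r01 : 0 <= r <= 1) (a0 : 0 < a) (b0 : 0 < b).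
Hypothesis mu_ab : ae_between mu a b.

Lemma real_integrable_rform_wgeomean (X : 'M[C]_N) v : posdef X ->
  real_integrable mu (fun A : BPD => rform (wgeomean r X (mx_of_PD A)) v).
Proof.
move=> pX; apply: (@real_integrable_ae_bounded _ _ _ _ _
    (rform (wgeomean r X (b%:Cx)%:M) v)).
- exact: measurable_rform_wgeomean.
apply: filterS mu_ab => A [_ Ab].
rewrite (ger0_norm (rform_wgeomean_ge0 _ _ A pX)).
exact: fle_wgeomeanr r01 pX (PD_posdef A) (posdef_scalar _ b0) Ab v.
Qed.

Lemma hermsymmx_powmap (X : 'M[C]_N) : posdef X -> powmap mu r X \is hermsymmx.
Proof.
move=> pX; apply: hermsymmx_mxintegral => [A|v].
  exact: posdef_herm (posdef_wgeomean r pX (PD_posdef A)).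
exact: real_integrable_rform_wgeomean.
Qed.

Lemma rform_powmap (X : 'M[C]_N) v : posdef X ->
  rform (powmap mu r X) v = \int[mu]_A rform (wgeomean r X (mx_of_PD A)) v.
Proof.
move=> pX; apply: rform_mxintegral => [A|u].
  exact: posdef_herm (posdef_wgeomean r pX (PD_posdef A)).
exact: real_integrable_rform_wgeomean.
Qed.

Lemma fle_powmap (X Y : 'M[C]_N) : posdef X -> posdef Y ->
  X ⪯ Y -> powmap mu r X ⪯ powmap mu r Y.
Proof.
move=> pX pY XY v.
rewrite [leLHS](rform_powmap _ pX) [leRHS](rform_powmap _ pY).
have intX := real_integrable_rform_wgeomean v pX.
have intY := real_integrable_rform_wgeomean v pY.
apply: (le_Rintegral measurableT intX intY) => A _.
exact: fle_wgeomeanl r01 pX pY (PD_posdef A) XY v.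
Qed.

Lemma powmapZ c (X : 'M[C]_N) : 0 < c -> posdef X ->
  powmap mu r (c%:Cx *: X) = (c `^ (1 - r))%:Cx *: powmap mu r X.
Proof.
move=> c0 pX; have pcX := posdefZ c0 pX.
apply: (eq_rform (hermsymmx_powmap pcX) (hermsymmxZ _ (hermsymmx_powmap pX))).
move=> v; rewrite [LHS](rform_powmap _ pcX) rformZ.
rewrite [X in _ * X](rform_powmap _ pX).
rewrite -(RintegralZl _ measurableT (real_integrable_rform_wgeomean v pX)).
apply: eq_Rintegral => A _.
by rewrite (wgeomeanZl _ c0 pX (PD_posdef A)) rformZ.
Qed.

Lemma powmap_ge_ae (X B : 'M[C]_N) : posdef X ->
  {ae mu, forall A : BPD, B ⪯ wgeomean r X (mx_of_PD A)} -> B ⪯ powmap mu r X.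
Proof.
move=> pX XB v; rewrite (rform_powmap _ pX).
rewrite -[leLHS](Rintegral_probability_cst mu).
apply: ae_le_Rintegral.
- exact: finite_measure_integrable_cst.
- exact: real_integrable_rform_wgeomean.
- by apply: filterS XB => A; apply.
Qed.

Lemma powmap_le_ae (X B : 'M[C]_N) : posdef X ->
  {ae mu, forall A : BPD, wgeomean r X (mx_of_PD A) ⪯ B} -> powmap mu r X ⪯ B.
Proof.
move=> pX XB v; rewrite (rform_powmap _ pX).
rewrite -[leRHS](Rintegral_probability_cst mu).
apply: ae_le_Rintegral.
- exact: real_integrable_rform_wgeomean.
- exact: finite_measure_integrable_cst.
- by apply: filterS XB => A; apply.
Qed.

Lemma posdef_powmap (X : 'M[C]_N) : posdef X -> posdef (powmap mu r X).
Proof.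
move=> pX; have pa := @posdef_scalar R N a a0.
apply: (posdef_fle (posdef_wgeomean r pX pa) (hermsymmx_powmap pX)).
apply: (powmap_ge_ae pX); apply: filterS mu_ab => A [aA _].
exact: fle_wgeomeanr r01 pX pa (PD_posdef A) aA.
Qed.

Lemma powmap_scalar_ge : (a%:Cx)%:M ⪯ powmap mu r (a%:Cx)%:M.
Proof.
have pa := @posdef_scalar R N a a0.
apply: (powmap_ge_ae pa); apply: filterS mu_ab => A [aA _].
rewrite -[X in X ⪯ _](wgeomean_id r pa).
exact: (fle_wgeomeanr r01 pa pa (PD_posdef A) aA).
Qed.

Lemma powmap_scalar_le : powmap mu r (b%:Cx)%:M ⪯ (b%:Cx)%:M.
Proof.
have pb := @posdef_scalar R N b b0.
apply: (powmap_le_ae pb); apply: filterS mu_ab => A [_ Ab].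
rewrite -[X in _ ⪯ X](wgeomean_id r pb).
exact: (fle_wgeomeanr r01 pb (PD_posdef A) pb Ab).
Qed.

End fixed_measure.
End power_map.

Section power_mean_equation.
Context {R : realType} {N : nat}.
Local Notation C := (Cx R).
Local Notation BPD := (borel (PD R N)).
Variables (mu : probability BPD R) (r a b : R).
Hypotheses (r0 : 0 < r) (r1 : r <= 1) (a0 : 0 < a) (b0 : 0 < b).
Hypothesis mu_ab : ae_between mu a b.

Let r01 : 0 <= r <= 1. Proof. by rewrite ltW. Qed.
Let p_itv : 0 <= 1 - r < 1. Proof. by rewrite subr_ge0 r1 gtrBl. Qed.

Lemma powmap_fixpoint_exists : exists X : PD R N, powmap mu r X = X.
Proof.
have pa := @posdef_scalar R N a a0; have pb := @posdef_scalar R N b b0.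
have [X pX XE] := fixpoint_exists p_itv (posdef_powmap r01 a0 b0 mu_ab)
  (fle_powmap r01 b0 mu_ab) (powmapZ r01 b0 mu_ab) pa pb
  (powmap_scalar_ge r01 a0 b0 mu_ab) (powmap_scalar_le r01 b0 mu_ab).
by exists (SigSub (mem_set pX)).
Qed.

Lemma power_meanP : powmap mu r (power_mean r mu) = power_mean r mu.
Proof.
have [X XE] := powmap_fixpoint_exists; apply/esym.
exact: (@getPex _ [set X : PD R N | X = powmap mu r X :> 'M[C]_N]
  (ex_intro _ X (esym XE))).
Qed.

Lemma fle_sub_powmap (D : 'M[C]_N) : posdef D -> D ⪯ powmap mu r D ->
  D ⪯ power_mean r mu.
Proof.
move=> pD DF; apply: (fle_sub_super_fixpoint p_itv (fle_powmap r01 b0 mu_ab)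
  (powmapZ r01 b0 mu_ab) pD (PD_posdef _) DF).
by rewrite power_meanP => v.
Qed.

End power_mean_equation.

(** * Power means of eigenvalues *)

Section eigenvalue_measure.
Context {R : realType} {N : nat}.
Local Notation C := (Cx R).
Local Notation BPD := (borel (PD R N)).

Definition borel_eigdiag : BPD -> BPD := @eigdiag R N.

Lemma measurable_borel_eigdiag : measurable_fun [set: BPD] borel_eigdiag.
Proof. exact: continuous_borel_measurable (@continuous_eigdiag R N). Qed.

HB.instance Definition _ :=
  isMeasurableFun.Build _ _ BPD BPD borel_eigdiag measurable_borel_eigdiag.

Lemma measurable_scalar_between (a b : R) :
  measurable [set A : BPD | scalar_between a b (mx_of_PD A)].
Proof.
have form_cont v : continuous (fun A : PD R N => rform A v).
  by move=> A; exact: cvg_rform (@continuous_PD_val R N A).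
have -> : [set A : BPD | scalar_between a b (mx_of_PD A)] =
    ~` \bigcup_v ([set A : PD R N | rform A v < a * sqnorm v] `|`
                  [set A : PD R N | b * sqnorm v < rform A v]).
  apply/seteqP; split=> A /=.
    move=> [aA Ab] [v _] [|] /=; apply/negP; rewrite -leNgt -rform_scalar.
      exact: aA.
    exact: Ab.
  move=> A_between; split=> v; rewrite rform_scalar leNgt; apply/negP => Av.
    by apply: A_between; exists v => //; left.
  by apply: A_between; exists v => //; right.
apply: measurableC; apply: sub_sigma_algebra.
apply: (@bigcup_open (PD R N)) => v _.
have /continuousP form_open := form_cont v.
apply: openU; first exact: form_open _ (@open_lt R (a * sqnorm v)).
exact: form_open _ (@open_gt R (b * sqnorm v)).
Qed.

Lemma rform_wgeomean_eigdiag r (d : 'rV[R]_N) (A : PD R N) v :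
  (forall i, 0 < d 0 i) ->
  rform (wgeomean r (rdiag d) (mx_of_PD (eigdiag A))) v =
    \sum_i d 0 i `^ (1 - r) * sqmod (v i 0) * eigvals (mx_of_PD A) 0 i `^ r.
Proof.
move=> d0; rewrite (wgeomean_rdiag _ d0) => [|i]; last first.
  exact: eigvals_gt0 (PD_posdef A).
rewrite rform_rdiag; apply: eq_bigr => i _.
by rewrite [(\row__ _) _ _]mxE mulrAC.
Qed.

Variables (mu : probability BPD R) (r a b : R).
Hypotheses (r0 : 0 < r) (r1 : r <= 1) (a0 : 0 < a) (b0 : 0 < b).
Hypothesis mu_ab : ae_between mu a b.

Let r01 : 0 <= r <= 1. Proof. by rewrite ltW. Qed.

Lemma ae_between_eigdiag : ae_between (distribution mu borel_eigdiag) a b.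
Proof.
have mS := measurableC (measurable_scalar_between a b).
have mS_eig := measurable_borel_eigdiag measurableT mS.
rewrite setTI in mS_eig; apply/(negligibleP _ mS).
rewrite /distribution /pushforward /=; apply/(negligibleP mu mS_eig).
apply: filterS mu_ab => A Aab.
rewrite -[mx_of_PD _]/(rdiag (eigvals (mx_of_PD A))) -conjdiag1.
apply: (scalar_between_conjdiag (unitarymx1 N)) => i.
exact: (eigvals_between i (posdef_herm (PD_posdef A)) Aab).
Qed.

Lemma ae_eigvals_pow_between i :
  {ae mu, forall A : BPD, a `^ r <= eigvals (mx_of_PD A) 0 i `^ r <= b `^ r}.
Proof.
apply: filterS mu_ab => A Aab.
have /andP[a_eig eig_b] := eigvals_between i (posdef_herm (PD_posdef A)) Aab.
have eig0 := ltW (eigvals_gt0 i (PD_posdef A)).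
by apply/andP; split; apply: ge0_ler_powR; rewrite ?nnegrE// ltW.
Qed.

Lemma real_integrable_eigvals_pow i :
  real_integrable mu (fun A : BPD => eigvals (mx_of_PD A) 0 i `^ r).
Proof.
apply: (@real_integrable_ae_bounded _ _ _ _ _ (b `^ r)).
  apply: (measurableT_comp (measurable_realfun.measurable_powR r)).
  exact: continuous_borel_measurable_realfun (@continuous_eigvals R N i).
apply: filterS (ae_eigvals_pow_between i) => A /andP[_ pow_b].
by rewrite ger0_norm ?powR_ge0.
Qed.

Definition eigvals_pmean : 'rV[R]_N :=
  \row_i (\int[mu]_A (eigvals (mx_of_PD A) 0 i `^ r)) `^ r^-1.

Lemma Rintegral_eigvals_pow_gt0 i :
  0 < \int[mu]_A (eigvals (mx_of_PD A) 0 i `^ r).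
Proof.
apply: (@lt_le_trans _ _ (a `^ r)); first exact: powR_gt0.
rewrite -[leLHS](Rintegral_probability_cst mu); apply: ae_le_Rintegral.
- exact: finite_measure_integrable_cst.
- exact: real_integrable_eigvals_pow.
- by apply: filterS (ae_eigvals_pow_between i) => A /andP[].
Qed.

Lemma eigvals_pmean_gt0 i : 0 < eigvals_pmean 0 i.
Proof. by rewrite mxE powR_gt0// Rintegral_eigvals_pow_gt0. Qed.

Lemma eigvals_pmean_pow i :
  eigvals_pmean 0 i `^ r = \int[mu]_A (eigvals (mx_of_PD A) 0 i `^ r).
Proof.
rewrite mxE -powRrM mulVf ?lt0r_neq0// powRr1//.
exact/ltW/Rintegral_eigvals_pow_gt0.
Qed.

Lemma powmap_eigvals_pmean :
  powmap (distribution mu borel_eigdiag) r (rdiag eigvals_pmean) =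
    rdiag eigvals_pmean.
Proof.
have pD : posdef (rdiag eigvals_pmean) := posdef_diag eigvals_pmean_gt0.
have nu_ab := ae_between_eigdiag.
apply: (eq_rform (hermsymmx_powmap r01 b0 nu_ab pD) (hermsymmx_rdiag _)) => v.
rewrite [LHS](rform_powmap r01 b0 nu_ab v pD).
have eig_int i := real_integrableZl (eigvals_pmean 0 i `^ (1 - r) *
  sqmod (v i 0)) (real_integrable_eigvals_pow i).
have formE : (fun A => rform (wgeomean r (rdiag eigvals_pmean) (mx_of_PD A)) v)
    \o borel_eigdiag = (fun A : BPD => \sum_i eigvals_pmean 0 i `^ (1 - r) *
      sqmod (v i 0) * eigvals (mx_of_PD A) 0 i `^ r).
  by apply/funext => A; exact: rform_wgeomean_eigdiag eigvals_pmean_gt0.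
rewrite Rintegral_distribution; first last.
- by rewrite formE; exact: real_integrable_sum.
- exact: measurable_rform_wgeomean.
rewrite [LHS](congr1 (fun f => \int[mu]_A f A) formE) Rintegral_sum//.
rewrite rform_rdiag; apply: eq_bigr => i _.
rewrite RintegralZl//; last exact: real_integrable_eigvals_pow.
rewrite -eigvals_pmean_pow mulrAC -powRD ?subrK ?powRr1//.
  exact/ltW/eigvals_pmean_gt0.
by rewrite gt_eqF ?implybT// eigvals_pmean_gt0.
Qed.

Lemma kyfan_powmap_le k (X : 'M[C]_N) : posdef X -> (k <= N)%N ->
  kyfan k (powmap mu r X) <=
    \sum_(i < N | (i < k)%N) eigvals X 0 i `^ (1 - r) * eigvals_pmean 0 i `^ r.
Proof.
move=> pX kN.
have [V V1 <-] := kyfan_attained (hermsymmx_powmap r01 b0 mu_ab pX) kN.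
rewrite (eq_bigr _ (fun j _ => rform_powmap r01 b0 mu_ab _ pX)).
have form_int v := real_integrable_rform_wgeomean r01 b0 mu_ab v pX.
have eig_int (i : 'I_N) := real_integrableZl (eigvals X 0 i `^ (1 - r))
  (real_integrable_eigvals_pow i).
rewrite -Rintegral_sum//.
rewrite [leRHS](eq_bigr (fun i => \int[mu]_A (eigvals X 0 i `^ (1 - r) *
    eigvals (mx_of_PD A) 0 i `^ r))) => [|i _]; last first.
  rewrite eigvals_pmean_pow RintegralZl//.
  exact: real_integrable_eigvals_pow.
rewrite -Rintegral_sum//; apply: le_Rintegral => // [||A _].
- exact: real_integrable_sum.
- exact: real_integrable_sum.
apply: le_trans (kyfan_wgeomean_le r01 pX (PD_posdef A) kN).
exact: kyfan_ge (posdef_herm (posdef_wgeomean r pX (PD_posdef A))) kN V1.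
Qed.

Lemma kyfan_power_mean_le k : (k <= N)%N ->
  kyfan k (power_mean r mu) <= \sum_(i < N | (i < k)%N) eigvals_pmean 0 i.
Proof.
move=> kN; have := power_meanP r0 r1 a0 b0 mu_ab.
move: (power_mean r mu) => X XE; have pX := PD_posdef X.
have young : kyfan k X <= (1 - r) * kyfan k X +
    r * \sum_(i < N | (i < k)%N) eigvals_pmean 0 i.
  have := kyfan_powmap_le pX kN; rewrite XE => /le_trans; apply.
  rewrite !mulr_sumr -big_split /=; apply: ler_sum => i _.
  apply: powR_young => //.
    exact: eigvals_gt0.
  exact: eigvals_pmean_gt0.
move: young; rewrite mulrBl mul1r -lerBlDl opprB addrC subrK.
by rewrite ler_pM2l.
Qed.

Lemma kyfan_power_mean_eigdiag_ge k : (k <= N)%N ->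
  \sum_(i < N | (i < k)%N) eigvals_pmean 0 i <=
    kyfan k (power_mean r (distribution mu borel_eigdiag)).
Proof.
move=> kN.
have pD : posdef (rdiag eigvals_pmean) := posdef_diag eigvals_pmean_gt0.
apply: le_trans (sum_le_kyfan_rdiag eigvals_pmean kN) _.
apply: (fle_kyfan (posdef_herm pD) (posdef_herm (PD_posdef _)) kN).
apply: (fle_sub_powmap r0 r1 a0 b0 ae_between_eigdiag pD).
by rewrite powmap_eigvals_pmean => v.
Qed.

End eigenvalue_measure.

Lemma bounded_support_ae_between (R : realType) (N : nat)
    (mu : {measure set (borel (PD R N)) -> \bar R}) :
  bounded_support mu -> exists2 e : R, 0 < e & ae_between mu e e^-1.
Proof.
move=> [e [e0 _ supp_e]]; exists e => //.
have mu_supp := ae_msupport mu second_countable_PD.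
apply: (@filterS _ _ (ae_filter_ringOfSetsType mu)) mu_supp => A /supp_e[eA Ae].
split; [exact: loewner_le_fle eA|exact: loewner_le_fle Ae].
Qed.

Theorem proposition7p5 (R : realType) (N : nat) (r : R)
    (mu : probability (borel (PD R N)) R) :
  0 < r -> r <= 1 -> bounded_support mu ->
  power_mean r mu ≺w power_mean r (eig_pushforward mu).
Proof.
move=> r0 r1 /bounded_support_ae_between[e e0 mu_e] k /andP[_ kN].
have e'0 : 0 < e^-1 by rewrite invr_gt0.
apply: le_trans (kyfan_power_mean_eigdiag_ge r0 r1 e0 e'0 mu_e kN).
exact: (kyfan_power_mean_le r0 r1 e0 e'0 mu_e kN).
Qed.
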